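(* Let $d\ge1$ be an integer. For all $l\in\mathbb{N}$, $D_l\equiv\tilde{D}_l\mod\mathcal{I}$; that is, for every $L$-function $p:\mathbb{N}\to[0,1]$, the probability that $G^{d+1}(n,p(n))$ satisfies exactly one of $D_l$ and $\tilde{D}_l$ tends to $0$ as $n\to\infty$.
   Context: $\mathbb{N}=\{0,1,2,\dots\}$. $G^{d+1}(n,p)$ is the random $(d+1)$-uniform hypergraph on $n$ labelled vertices in which each of the $\binom{n}{d+1}$ potential edges ($(d+1)$-element vertex sets) is present with probability $p$, independently of the others. An $L$-function (Hardy's logarithmico-exponential function) is a real-valued function, defined for all large $n$, given by a finite combination of the ordinary algebraic symbols ($+,-,\times,\div$, roots) and the functional symbols $\log(\cdot)$ and $\exp(\cdot)$ applied to the variable $n$ and real constants, such that at all stages of the construction the functions take only real values. A butterfly is a connected Berge-acyclic $(d+1)$-uniform hypergraph (its bipartite vertex-edge incidence graph has no cycles); the order of a finite butterfly is its number of edges (a single vertex has order $0$). A hypergraph satisfies $D_l$ if the complement of a connected component of maximal size is a disjoint union of finite butterflies, all of order less than $l$; by convention $D_0$ is the property of being connected. $\tilde{D}_l=A\lor B$, where $A$ is the property that there are no connected components isomorphic to butterflies of order $l$, and $B$ is the property that the largest connected component is a butterfly of order $l$ and all other components are butterflies of order $<l$. $\mathcal{I}$ is the set of all isomorphism-invariant properties $P$ of $(d+1)$-uniform hypergraphs such that $\mathbb{P}[G^{d+1}(n,p(n))\models P]\to0$ for all $L$-functions $p:\mathbb{N}\to[0,1]$; $P_1\equiv P_2\mod\mathcal{I}$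 means that the symmetric difference $P_1\triangle P_2$ belongs to $\mathcal{I}$. *)

(* Defs.v *)
From HB Require Import structures.
From mathcomp Require Import all_boot all_order all_algebra.
From mathcomp Require Import all_classical all_reals all_analysis.

Set Implicit Arguments.
Unset Strict Implicit.
Unset Printing Implicit Defensive.

Import Order.TTheory GRing.Theory Num.Theory.
Import numFieldNormedType.Exports.

Local Open Scope ring_scope.

Record hypergraph (k : nat) (V : finType) := Hypergraph {
  edges :> {set {set V}};
  _ : [forall e in edges, #|e| == k]
}.

HB.instance Definition _ k V := [isSub for @edges k V].
HB.instance Definition _ k V := [Finite of hypergraph k V by <:].

Section Hypergraph.
Variables (k : nat) (V : finType).
Implicit Types (H : hypergraph k V) (C : {set V}).

Definition adjacent H : rel V :=
  [rel u v | [exists e in edges H, (u \in e) && (v \in e)]].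

Definition component H (v : V) : {set V} :=
  [set w | connect (adjacent H) v w].

Definition components H : {set {set V}} := [set component H v | v : V].

Definition connected_hypergraph H : Prop := #|components H| = 1%N.

Definition incidence H : rel (V + {set V}) := fun x y =>
  match x, y with
  | inl v, inr e | inr e, inl v => (e \in edges H) && (v \in e)
  | _, _ => false
  end.

(* [ucycle] also accepts [:: x; y] for adjacent x and y; genuine cycles have at
   least three vertices. *)
Definition berge_acyclic H : Prop :=
  forall c : seq (V + {set V}), ucycle (incidence H) c -> (size c <= 2)%N.

Definition butterfly H : Prop := connected_hypergraph H /\ berge_acyclic H.

End Hypergraph.

Section Components.
Variables (k : nat) (V : finType).
Implicit Types (H : hypergraph k V) (C : {set V}).

Lemma induced_subproof H C :
  [forall e in [set [set v : {v : V | v \in C} | val v \in e]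
                 | e : {set V} in edges H & e \subset C], #|e| == k].
Proof.
apply/forall_inP => _ /imsetP[e /[!inE]/andP[He eC] ->].
have /forall_inP/(_ e He)/eqP <- := valP H.
rewrite -(card_imset _ val_inj); apply/eqP; congr #|pred_of_set _|.
apply/setP => v; apply/imsetP/idP => [[w /[!inE] we ->] //|ve].
by exists (exist _ v (fintype.subsetP eC v ve)); rewrite ?inE.
Qed.

Definition induced H C : hypergraph k {v : V | v \in C} :=
  Hypergraph (induced_subproof H C).

Definition largest_component H C : Prop :=
  C \in components H /\
  forall C', C' \in components H -> (#|C'| <= #|C|)%N.

Definition butterfly_component H C (l : nat) : Prop :=
  butterfly (induced H C) /\ #|edges (induced H C)| = l.

Definition others_small_butterflies H C (l : nat) : Prop :=
  forall C', C' \in components H -> C' != C ->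
    exists2 m, (m < l)%N & butterfly_component H C' m.

End Components.

Definition property (k : nat) := forall V : finType, hypergraph k V -> Prop.

Definition hypergraph_iso k (V W : finType)
    (H : hypergraph k V) (K : hypergraph k W) : Prop :=
  exists2 f : V -> W, bijective f &
    edges K = [set f @: (e : {set V}) | e in edges H].

Definition iso_invariant k (P : property k) : Prop :=
  forall (V W : finType) (H : hypergraph k V) (K : hypergraph k W),
    hypergraph_iso H K -> (P V H <-> P W K).

Definition symdiff k (P Q : property k) : property k :=
  fun V H => (P V H /\ ~ Q V H) \/ (Q V H /\ ~ P V H).

(* For l = 0 no component other than C is allowed, so that [D 0] says that the
   hypergraph is connected (lemma [D0E]). *)
Definition D k (l : nat) : property k := fun V H =>
  exists2 C, largest_component H C & others_small_butterflies H C l.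

Definition no_butterfly_component k (l : nat) : property k := fun V H =>
  forall C, C \in components H -> ~ butterfly_component H C l.

Definition largest_is_butterfly k (l : nat) : property k := fun V H =>
  exists2 C, largest_component H C &
    butterfly_component H C l /\ others_small_butterflies H C l.

Definition Dtilde k (l : nat) : property k := fun V H =>
  no_butterfly_component l H \/ largest_is_butterfly l H.

Lemma D0E k (V : finType) (H : hypergraph k V) :
  D 0 H <-> connected_hypergraph H.
Proof.
split=> [[C [CH _] others]|/eqP/cards1P[C HC]].
  apply/eqP/cards1P; exists C; apply/setP => C'; rewrite finset.in_set1.
  apply/idP/eqP => [C'H|-> //]; apply/eqP/negPn/negP => /(others _ C'H).
  by case.
exists C; first by split=> [|C']; rewrite HC finset.in_set1 // => /eqP ->.
by move=> C'; rewrite HC finset.in_set1 => /eqP ->; rewrite eqxx.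
Qed.

Local Open Scope classical_set_scope.

(* Functions on nat are total; the values for small n are irrelevant, which is
   what [L_eventually] expresses.  In [L_root], g is the real k-th root of f,
   the nonnegative one when k is even. *)
Inductive L_function (R : realType) : (nat -> R) -> Prop :=
| L_var : L_function (fun n => n%:R)
| L_const (c : R) : L_function (fun=> c)
| L_add f g : L_function f -> L_function g -> L_function (fun n => f n + g n)
| L_sub f g : L_function f -> L_function g -> L_function (fun n => f n - g n)
| L_mul f g : L_function f -> L_function g -> L_function (fun n => f n * g n)
| L_div f g : L_function f -> L_function g ->
    (\forall n \near \oo, g n != 0) -> L_function (fun n => f n / g n)
| L_root (k : nat) f g : (0 < k)%N -> L_function f ->
    (\forall n \near \oo, g n ^+ k = f n /\ (~~ odd k -> 0 <= g n)) ->
    L_function g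
| L_log f : L_function f -> (\forall n \near \oo, 0 < f n) ->
    L_function (fun n => ln (f n))
| L_exp f : L_function f -> L_function (fun n => expR (f n))
| L_eventually f g : L_function f -> (\forall n \near \oo, f n = g n) ->
    L_function g.

Section Random.
Variables (R : realType) (d : nat).

Definition random_weight (n : nat) (p : R) (H : hypergraph d.+1 'I_n) : R :=
  \prod_(e : {set 'I_n} | #|e| == d.+1) (if e \in edges H then p else 1 - p).

Definition random_prob (n : nat) (p : R) (P : property d.+1) : R :=
  \sum_(H : hypergraph d.+1 'I_n | `[< P _ H >]) random_weight p H.

Definition in_I (P : property d.+1) : Prop :=
  iso_invariant P /\
  forall p : nat -> R, L_function p -> (forall n, 0 <= p n <= 1) ->
    (fun n => random_prob n (p n) P) @ \oo --> (0 : R).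

Definition equiv_mod_I (P Q : property d.+1) : Prop := in_I (symdiff P Q).

End Random.

(* Main.v *)
Require Import Defs.
From mathcomp Require Import all_boot all_order all_algebra.
From mathcomp Require Import all_classical all_reals all_analysis.
From mathcomp Require Import fintype finset zify lra ring.
Require Import Defs.

Set Implicit Arguments.
Unset Strict Implicit.
Unset Printing Implicit Defensive.

Import Order.TTheory GRing.Theory Num.Theory.

(** Write k = d + 1, y = p n^d and L = ln n.

    If [D l] holds with large component C and some component is a butterfly of
    order l, that component is C itself, so [Dtilde l] holds.  Hence the
    symmetric difference is the event that no component is a butterfly of order
    l although [D l] fails ([symdiff_D_Dtilde]).  On that event, a component
    other than a largest one is not a butterfly of order at most l; such a
    component has at most n / 2 vertices.  A connected hypergraph with e edges
    has at most d e + 1 vertices, and at most d e if it contains a cycle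
    ([connected_flag_count]).  So an exceptional component on s vertices carries
    at least [excess_edges d l s] edges: it has more than l edges, or it has
    e edges with d e >= s ([exceptional_component]).

    Put a = 2 / (2 l + 1) and c = 2 d! / (2 (l d + 1) + 1).  A tree with l edges
    is expected to occur when y exceeds n^(-1/l), and isolated trees with l
    edges die out when y exceeds d! L / (l d + 1).  The values n^(-a) and c L
    lie strictly between these thresholds for l and those for l + 1, and they
    split the possible values of p into two regimes.

    - If y <= n^(-a) or y >= c L, the expected number of sets of vertices that
      look like an exceptional component tends to 0.  A set of s vertices
      contributes at most (32 d)^s n^j y^t exp (- p s 'C(n - s, d)), with
      t = [excess_edges d l s] and j = s - d t, which is 0 or 1
      ([exceptional_bound_le]).  For large s this is at most n^(-2)
      ([exceptional_tail]); for each fixed s it tends to 0, which is where the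
      position of n^(-a) and c L relative to the thresholds for l + 1 matters
      ([exceptional_fixed]).
    - Otherwise the expected number of components that are butterflies of order
      l grows like a power of n, and the second moment method produces one with
      probability tending to 1 ([prob_no_butterfly], [middle_regime]).

    All estimates are uniform in p, so the regime may be chosen separately for
    each n.  *)

(** * Rooted paths and cycles in finite graphs *)

(** [dist] is the length of a shortest path from [r], and [par x] is the last
    but one vertex of such a path; the strict decrease of [dist] along [par] is
    what makes x |-> {x, par x} injective on the vertices other than [r]. *)
Lemma connect_rank (T : finType) (g : rel T) (r : T) :
  exists dist : T -> nat, exists par : T -> T,
    forall x, connect g r x -> x != r -> g (par x) x /\ (dist (par x) < dist x)%N.
Proof.
pose reach x n := [exists p : n.-tuple T, path g r p && (last r p == x)].
have reachP x : connect g r x -> exists n, reach x n.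
  move=> /connectP[p pp ->]; exists (size p); apply/existsP.
  by exists (in_tuple p); rewrite pp eqxx.
pose dist x := if pselect (exists n, reach x n) is left h then ex_minn h else 0%N.
have dist_reach x : connect g r x -> reach x (dist x).
  by move=> /reachP h; rewrite /dist; case: pselect => // h'; case: ex_minnP.
have dist_min x n : reach x n -> (dist x <= n)%N.
  move=> rn; rewrite /dist; case: pselect => // h'.
  by case: ex_minnP => m _; apply.
have par x : {y | connect g r x -> x != r -> g y x /\ (dist y < dist x)%N}.
  apply: cid; case: (boolP (connect g r x)) => [cx|]; last by exists r.
  have /existsP[[p /= sp] /andP[pp /eqP lx]] := dist_reach _ cx.
  case/lastP: p sp pp lx => [|q z] sp.
    by move=> _ /= ->; exists x; rewrite eqxx.
  rewrite rcons_path last_rcons => /andP[pq gz] zx.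
  exists (last r q) => _ _; split; first by rewrite -zx.
  rewrite -(eqP sp) size_rcons ltnS; apply: dist_min.
  by apply/existsP; exists (in_tuple q); rewrite /= pq eqxx.
by exists dist, (fun x => sval (par x)) => x; case: (par x).
Qed.

(** The bound on the size rules out the degenerate cycles x, y, where the
    predecessor and the successor of x coincide. *)
Lemma cycle_neighbours (T : eqType) (g : rel T) (c : seq T) x :
  ucycle g c -> (2 < size c)%N -> x \in c ->
  exists y z, [/\ y \in c, z \in c, y != z, g y x & g x z].
Proof.
move=> /andP[cyc un] sc xc.
have [i s def_c] := rot_to xc.
have un' : uniq (x :: s) by rewrite -def_c rot_uniq.
have cyc' : cycle g (x :: s) by rewrite -def_c rot_cycle.
have memc u : u \in x :: s -> u \in c by rewrite -def_c mem_rot.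
have : (2 < size (x :: s))%N by rewrite -def_c size_rot.
case: s un' cyc' memc {def_c} => [|z [|w s]] // un' cyc' memc _.
exists (last w s), z.
move: cyc'; rewrite (cycle_path x) /= => /and4P[gx gxz gzw ps].
have lw : last w s \in w :: s by rewrite mem_last.
split=> //; try (apply: memc; rewrite !inE ?eqxx ?orbT //).
  by move: lw; rewrite !inE => /orP[]->; rewrite ?orbT.
move: un' => /= /and3P[_ zn _]; apply/eqP => e.
by move/negP: zn; apply; rewrite -e.
Qed.

(** * Counting vertices and edges of a connected hypergraph *)

(** The flag (vertex, edge) underlying an unordered incident pair; the values on
    pairs of the same kind are junk. *)
Definition flag_of (V : finType) (v0 : V) (x y : V + {set V}) : V * {set V} :=
  match x, y with
  | inl v, inr e | inr e, inl v => (v, e)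
  | inl v, inl _ => (v, set0)
  | inr e, inr _ => (v0, e)
  end.

Lemma flag_of_eq k (V : finType) (H : hypergraph k V) v0 x y x' y' :
  incidence H x y -> incidence H x' y' -> flag_of v0 x y = flag_of v0 x' y' ->
  (x = x' /\ y = y') \/ (x = y' /\ y = x').
Proof.
by case: x y x' y' => [v|e] [w|f] [v'|e'] [w'|f'] //= _ _ [-> ->]; auto.
Qed.

Lemma incidence_sym k (V : finType) (H : hypergraph k V) : symmetric (incidence H).
Proof. by case=> [v|e] [w|f]. Qed.

Definition flags k (V : finType) (H : hypergraph k V) : {set V * {set V}} :=
  [set f | (f.2 \in edges H) && (f.1 \in f.2)].

Lemma card_edge k (V : finType) (H : hypergraph k V) e : e \in edges H -> #|e| = k.
Proof. by move=> He; have /forall_inP/(_ e He)/eqP := valP H. Qed.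

Lemma card_flags k (V : finType) (H : hypergraph k V) :
  #|flags H| = (k * #|edges H|)%N.
Proof.
have -> : flags H = \bigcup_(e in edges H) [set (v, e) | v in e].
  apply/setP => -[v e]; rewrite inE /=; apply/andP/bigcupP.
    by move=> [He ve]; exists e => //; apply/imsetP; exists v.
  by move=> [f Hf /imsetP[w wf [-> ->]]].
rewrite -sum1_card.
rewrite (partition_big (fun f : V * {set V} => f.2) (fun e => e \in edges H)) /=; last first.
  by move=> f /bigcupP[e He /imsetP[v ve ->]].
rewrite -[RHS]mulnC -sum_nat_const; apply: eq_bigr => e He.
transitivity #|e|; last exact: card_edge He.
rewrite -[RHS](card_imset e (f := fun v => (v, e))); last by move=> u v [].
rewrite sum1_card; apply: eq_card => -[v f]; rewrite [LHS]inE /=.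
apply/andP/imsetP => [[/bigcupP[e' He' /imsetP[w we [-> ->]]] /eqP ee]|[w we [-> ->]]].
  by exists w; rewrite -?ee.
split=> //; apply/bigcupP; exists e => //; apply/imsetP; by exists w.
Qed.

Lemma connect_incidence k (V : finType) (H : hypergraph k V) u v :
  connect (adjacent H) u v -> connect (incidence H) (inl u) (inl v).
Proof.
move=> /connectP[p]; elim: p u => [|w p IH] u /=; first by move=> _ ->; exact: connect0.
move=> /andP[/existsP[e /andP[He /andP[ue we]]] pp vE].
apply: (connect_trans _ (IH _ pp vE)).
by apply: (@connect_trans _ _ (inr e)); apply: connect1; rewrite /= He.
Qed.

(** Each vertex and each edge other than the root [v0] sends its flag to its
    parent in a breadth-first tree of the incidence graph, and these flags are
    distinct, so |V| + |E| - 1 is at most the number (k + 1) |E| of flags.  On a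
    cycle, the element farthest from the root has two neighbours that are no
    farther, only one of which is its parent; the flag of the other one is
    missed, which sharpens the inequality by 1. *)
Lemma connected_flag_count k (V : finType) (H : hypergraph k.+1 V) (v0 : V) :
  (forall v, connect (adjacent H) v0 v) ->
  (#|V| + #|edges H| <= (k.+1 * #|edges H|).+1)%N /\
  (~ berge_acyclic H -> #|V| + #|edges H| <= k.+1 * #|edges H|)%N.
Proof.
move=> conn.
have [dist [par parP]] := connect_rank (incidence H) (inl v0).
pose A : {set V + {set V}} := [set x | if x is inr e then e \in edges H else true].
have cA x : x \in A -> connect (incidence H) (inl v0) x.
  case: x => [v _|e]; first exact: connect_incidence.
  rewrite inE => He; have /card_gt0P[v ve] : (0 < #|e|)%N by rewrite (card_edge He).
  apply: connect_trans (connect_incidence (conn v)) _.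
  by apply: connect1; rewrite /= He.
have cardA : #|A| = (#|V| + #|edges H|)%N.
  have -> : A = (inl @: [set: V]) :|: (inr @: edges H).
    apply/setP => -[v|e]; rewrite !inE.
      by symmetry; apply/orP; left; apply/imsetP; exists v.
    apply/idP/orP => [He|[/imsetP[] //|/imsetP[f Hf [->]] //]].
    by right; apply/imsetP; exists e.
  rewrite cardsU (_ : _ :&: _ = set0) ?cards0 ?subn0; last first.
    by apply/setP => x; rewrite !inE; apply/negP => /andP[/imsetP[? _ ->] /imsetP[]].
  by rewrite !card_imset ?cardsT //; [exact: inr_inj|exact: inl_inj].
pose B := A :\ inl v0.
have parB x : x \in B -> incidence H (par x) x /\ (dist (par x) < dist x)%N.
  by rewrite in_setD1 => /andP[xr xA]; apply: parP => //; apply: cA.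
pose phi x := flag_of v0 x (par x).
(* two elements with the same flag would be each other's parent *)
have phi_inj : {in B &, injective phi}.
  move=> x y /parB[gx dx] /parB[gy dy] /(@flag_of_eq _ _ H) e.
  move: gx gy; rewrite !(incidence_sym H (par _)) => gx gy.
  by have [[]//|[xy yx]] := e gx gy; move: dx dy; rewrite yx -xy; lia.
have flagP x y : incidence H x y -> flag_of v0 x y \in flags H.
  by case: x y => [v|e] [w|f] //=; rewrite inE.
have cardB : #|B|.+1 = (#|V| + #|edges H|)%N.
  by rewrite -cardA (cardsD1 (inl v0) A) inE.
have sub : phi @: B \subset flags H.
  apply/fintype.subsetP => _ /imsetP[x /parB[gx _] ->].
  by apply: flagP; rewrite incidence_sym.
rewrite -cardB -card_flags -(card_in_imset phi_inj) ltnS; split.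
  exact: subset_leq_card.
move=> /existsNP[c /not_implyP[uc /negP]]; rewrite -ltnNge => sc.
have memA x y : incidence H x y -> x \in A.
  by case: x y => [v|e] [w|f] //=; rewrite inE //; case/andP.
have [x0 x0c] : exists x, x \in c by case: c sc {uc} => [|x c] // _; exists x; rewrite inE eqxx.
(* an element of the cycle farthest from the root *)
have [x xc xmax] : exists2 x, x \in c & forall y, y \in c -> (dist y <= dist x)%N.
  by case: (arg_maxnP dist x0c) => x xc xmax; exists x.
have [y [z [yc zc yz gy gz]]] := cycle_neighbours uc sc xc.
have [w [wc gw wx]] : exists w, [/\ w \in c, incidence H x w & w != par x].
  have [e|ne] := eqVneq y (par x); last by exists y; rewrite incidence_sym.
  by exists z; rewrite -e eq_sym yz.
apply: proper_card; rewrite properE sub /=; apply/subsetPn.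
exists (flag_of v0 x w); first exact: flagP.
apply/negP => /imsetP[u uB e]; have [gu du] := parB _ uB.
rewrite incidence_sym in gu.
have [[xu wu]|[xu wu]] := flag_of_eq gw gu e.
  by move/eqP: wx; rewrite wu xu.
by have := xmax _ wc; rewrite wu xu leqNgt du.
Qed.

(** * Components of a hypergraph *)

Lemma connect_adjacent_sym k (V : finType) (H : hypergraph k V) :
  connect_sym (adjacent H).
Proof.
apply: sym_connect_sym => u v /=.
by apply: eq_existsb => e; rewrite [X in _ && X]andbC.
Qed.

Lemma mem_component k (V : finType) (H : hypergraph k V) v : v \in component H v.
Proof. by rewrite inE connect0. Qed.

Lemma component_in k (V : finType) (H : hypergraph k V) v :
  component H v \in components H.
Proof. by apply/imsetP; exists v. Qed.

Lemma components_eq k (V : finType) (H : hypergraph k V) C v :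
  C \in components H -> v \in C -> C = component H v.
Proof.
move=> /imsetP[u _ ->]; rewrite inE => uv; apply/setP => w; rewrite !inE.
exact: (same_connect (@connect_adjacent_sym _ _ H)).
Qed.

Lemma component_closed k (V : finType) (H : hypergraph k V) C e v :
  C \in components H -> e \in edges H -> v \in e -> v \in C -> e \subset C.
Proof.
move=> HC He ve vC; rewrite (components_eq HC vC); apply/fintype.subsetP => w we.
by rewrite inE; apply: connect1; apply/existsP; exists e; rewrite He ve.
Qed.

Lemma connected_from k (V : finType) (H : hypergraph k V) r :
  (forall v, connect (adjacent H) r v) -> connected_hypergraph H.
Proof.
move=> conn; apply/eqP/cards1P; exists (component H r).
apply/setP => C; rewrite finset.in_set1; apply/idP/eqP => [HC|->]; last exact: component_in.
case/imsetP: (HC) => v _ eC; rewrite -(components_eq HC) // eC inE.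
by rewrite connect_adjacent_sym.
Qed.

Definition inner k (V : finType) (H : hypergraph k V) (C : {set V}) : {set {set V}} :=
  [set e in edges H | e \subset C].

Lemma imset_val_sub (V : finType) (C e : {set V}) : e \subset C ->
  [set val v | v in [set v : {v : V | v \in C} | val v \in e]] = e.
Proof.
move=> eC; apply/setP => v; apply/imsetP/idP => [[w /[!inE] we -> //]|ve].
by exists (exist _ v (fintype.subsetP eC v ve)); rewrite ?inE.
Qed.

Lemma card_edges_induced k (V : finType) (H : hypergraph k V) C :
  #|edges (induced H C)| = #|inner H C|.
Proof.
rewrite /inner -[RHS](card_in_imset
  (f := fun e : {set V} => [set v : {v : V | v \in C} | val v \in e])).
  by apply: eq_card => f; apply/imsetP/imsetP => -[e eH ->]; exists e;
    rewrite ?inE in eH *.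
move=> e f; rewrite !inE => /andP[_ eC] /andP[_ fC] ef.
by rewrite -(imset_val_sub eC) ef imset_val_sub.
Qed.

Lemma connect_induced k (V : finType) (H : hypergraph k V) C :
  C \in components H -> forall u v : {v : V | v \in C}, connect (adjacent (induced H C)) u v.
Proof.
move=> HC u v.
have : connect (adjacent H) (val u) (val v).
  suff : val v \in component H (val u) by rewrite inE.
  rewrite -(components_eq HC (valP u)); exact: (valP v).
move=> /connectP[p]; elim: p u => [|w p IH] u /=.
  by move=> _ /val_inj ->; exact: connect0.
move=> /andP[/existsP[e /andP[He /andP[ue we]]] pp vE].
have eC := component_closed HC He ue (valP u).
have wC := fintype.subsetP eC w we.
apply: (connect_trans _ (IH (exist _ w wC) pp vE)); apply: connect1.
apply/existsP; exists [set v : {v : V | v \in C} | val v \in e].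
by rewrite !inE /= ue we !andbT; apply/imsetP; exists e; rewrite // inE He.
Qed.

(** [connected_flag_count] for the hypergraph induced on a component: when the
    bound on the number of vertices is attained there is no room for a cycle, so
    that the number of vertices alone certifies a butterfly. *)
Lemma component_count d (V : finType) (H : hypergraph d.+1 V) C :
  C \in components H ->
  (#|C| <= (d * #|inner H C|).+1)%N /\
  ((d * #|inner H C| < #|C|)%N -> butterfly_component H C #|inner H C|).
Proof.
move=> HC; have [r rC] : exists r, r \in C.
  by case/imsetP: HC => v _ ->; exists v; exact: mem_component.
have conn := connect_induced HC (exist _ r rC).
have [le1 le2] := connected_flag_count conn.
have cC : #|{: {v : V | v \in C}}| = #|C| by rewrite card_sig; apply: eq_card.
rewrite card_edges_induced cC mulSn in le1 le2.
split=> [|ltC]; first by lia.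
split; last exact: card_edges_induced.
split; first exact: connected_from conn.
apply: contrapT => /le2; lia.
Qed.

Lemma inner_card_gt1 d (V : finType) (H : hypergraph d.+1 V) C :
  (0 < d)%N -> (0 < #|inner H C|)%N -> (1 < #|C|)%N.
Proof.
move=> d0 /card_gt0P[e]; rewrite inE => /andP[He eC].
by have := subset_leq_card eC; rewrite (card_edge He); lia.
Qed.

(** * Exceptional components and planted butterflies *)

(** A lower bound for the number of edges of a connected hypergraph on s vertices
    that is not a butterfly of order at most l.  When s <= l d + 1 the tree on s
    vertices has order at most l, so one edge more than (s - 1) / d is needed:
    that is the ceiling of s / d.  For larger s every connected hypergraph
    qualifies and the value is the ceiling of (s - 1) / d.  Both ceilings are
    written as a floor plus one. *)
Definition excess_edges d l s := ((s - (if (s <= l * d + 1)%N then 1 else 2)) %/ d).+1.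

Lemma excess_edges_span d l s : (0 < d)%N -> (s <= (d * excess_edges d l s).+1)%N.
Proof.
move=> d0; rewrite /excess_edges; set b := s - _.
have sb : (s <= b + 2)%N by rewrite /b; case: ifP => _; lia.
have := ltn_ceil b d0; rewrite mulnC; lia.
Qed.

Lemma excess_edges_le d l s : (0 < s)%N -> (excess_edges d l s <= s)%N.
Proof.
move=> s0; rewrite /excess_edges; set b := s - _.
have bs : (b < s)%N by rewrite /b; case: ifP => _; lia.
by apply: leq_ltn_trans (leq_div b d) bs.
Qed.

(** The only sizes for which trees count as exceptional are those of trees with
    more than l edges. *)
Lemma excess_edges_tight d l s : (0 < d)%N -> (1 < s)%N ->
  (d * excess_edges d l s < s)%N -> (l < excess_edges d l s)%N /\ (l * d + 1 < s)%N.
Proof.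
move=> d0 s1; rewrite /excess_edges; case: ifP => sl h.
  by have := ltn_ceil (s - 1) d0; rewrite mulnC; lia.
split; last by lia.
by rewrite ltnS leq_divRL //; lia.
Qed.

Lemma excess_edges_min d l s e : (0 < d)%N -> (1 < s)%N -> (s <= (d * e).+1)%N ->
  (l < e)%N \/ (s <= d * e)%N -> (excess_edges d l s <= e)%N.
Proof.
move=> d0 s1 se h; rewrite /excess_edges ltn_divLR //.
case: ifP => sl; last by rewrite mulnC; lia.
case: h => h; last by rewrite mulnC; lia.
apply: (@leq_trans (l.+1 * d)); last by rewrite leq_mul2r h orbT.
by rewrite mulSn; lia.
Qed.

Lemma symdiff_D_Dtilde k l (V : finType) (H : hypergraph k V) :
  symdiff (@D k l) (@Dtilde k l) H -> no_butterfly_component l H /\ ~ D l H.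
Proof.
case=> [[[C HC oC] nD]|[[A|[C HC [bC oC]]] nD]]; [|by []|by case: nD; exists C].
case: nD; have [b|nb] := pselect (butterfly_component H C l).
  by right; exists C.
left=> C' HC' bC'; have [CC|/(oC _ HC')[m ml [_ cm]]] := eqVneq C' C.
  by rewrite CC in bC'.
by case: bC' => _; rewrite cm => ml'; rewrite ml' ltnn in ml.
Qed.

Lemma exists_largest k (V : finType) (H : hypergraph k V) (v : V) :
  exists C, largest_component H C.
Proof.
case: (arg_maxnP (fun C : {set V} => #|C|) (component_in H v)) => C HC mC.
by exists C.
Qed.

Lemma two_components k (V : finType) (H : hypergraph k V) C C' :
  C \in components H -> C' \in components H -> C' != C -> (#|C| + #|C'| <= #|V|)%N.
Proof.
move=> HC HC' CC; have dis : C :&: C' = set0.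
  apply/setP => v; rewrite !inE; apply/negP => /andP[vC vC'].
  by move/eqP: CC; apply; rewrite (components_eq HC vC) (components_eq HC' vC').
by rewrite -cardsUI dis cards0 addn0 max_card.
Qed.

(** The component produced differs from a largest one, and the two are disjoint:
    this is why it covers at most half of the vertices. *)
Lemma exceptional_component d l (V : finType) (H : hypergraph d.+1 V) (v : V) :
  (0 < d)%N -> no_butterfly_component l H -> ~ D l H ->
  exists S : {set V}, [/\ S \in components H, (1 < #|S|)%N, (#|S|.*2 <= #|V|)%N &
    (excess_edges d l #|S| <= #|inner H S|)%N].
Proof.
move=> d0 nb nD; have [C [HC mC]] := exists_largest H v.
have : ~ others_small_butterflies H C l by move=> o; apply: nD; exists C.
move=> /existsNP[S /not_implyP[HS /not_implyP[SC nS]]].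
have [le1 bS] := component_count HS.
have big : (l < #|inner H S|)%N \/ (#|S| <= d * #|inner H S|)%N.
  have [lt|_] := ltnP (d * #|inner H S|) #|S|; last by right.
  left; rewrite ltnNge leq_eqVlt; apply/negP => /orP[/eqP e|lte].
    by apply: (nb S HS); rewrite -e; exact: bS.
  by apply: nS; exists #|inner H S| => //; exact: bS.
have S1 : (1 < #|S|)%N.
  apply: (inner_card_gt1 (H := H) d0); case: big; first by case: #|inner _ _|.
  have [r rS] : exists r, r \in S.
    by case/imsetP: HS => u _ ->; exists u; exact: mem_component.
  have : (0 < #|S|)%N by apply/card_gt0P; exists r.
  by case: #|inner _ _| => //; rewrite muln0; lia.
exists S; split=> //; last exact: excess_edges_min.
have := two_components HC HS SC; have := mC _ HS; lia.
Qed.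

Definition linked (V : finType) (E : {set {set V}}) : rel V :=
  fun u v => [exists e in E, (u \in e) && (v \in e)].

(** Each step attaches one edge at a vertex of a smaller butterfly, the d other
    vertices of the edge being new. *)
Lemma exists_butterfly_edges d l (V : finType) (S : {set V}) : (0 < d)%N ->
  #|S| = (l * d).+1 -> exists E : {set {set V}},
  [/\ forall e, e \in E -> e \subset S /\ #|e| = d.+1, #|E| = l &
      forall u v, u \in S -> v \in S -> connect (linked E) u v].
Proof.
move=> d0; elim: l S => [|l IH] S cS.
  exists set0; split=> [e|//|u v]; rewrite ?inE ?cards0 //.
  have /cards1P[x ->] : #|S| == 1 by rewrite cS.
  by rewrite !finset.in_set1 => /eqP -> /eqP ->; exact: connect0.
have [S' S'S cS'] : exists2 S' : {set V}, S' \subset S & #|S'| = (l * d).+1.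
  have : (0 < #|[set A : {set V} | A \subset S & #|A| == (l * d).+1]|)%N.
    by rewrite cards_draws cS bin_gt0; rewrite mulSn; lia.
  by case/card_gt0P => A; rewrite inE => /andP[? /eqP ?]; exists A.
have [E [Esub cE Econn]] := IH S' cS'.
have /card_gt0P[u uS'] : (0 < #|S'|)%N by rewrite cS'.
pose e := u |: (S :\: S').
have ce : #|e| = d.+1.
  rewrite cardsU1 !inE uS' /= cardsD (setIidPr S'S) cS cS' mulSn; lia.
have eS : e \subset S.
  by rewrite subUset sub1set (fintype.subsetP S'S u uS') subsetDl.
have eE : e \notin E.
  have [w we] : exists w, w \in S :\: S'.
    apply/card_gt0P; rewrite cardsD (setIidPr S'S) cS cS' mulSn; lia.
  apply/negP => /Esub[/fintype.subsetP/(_ w)]; rewrite in_setU1 we orbT => /(_ isT) wS' _.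
  by move: we; rewrite inE wS'.
exists (e |: E); split.
- move=> f; rewrite in_setU1 => /orP[/eqP -> //|/Esub[fS' ?]].
  by split=> //; exact: subset_trans S'S.
- by rewrite cardsU1 eE cE.
have sub : subrel (connect (linked E)) (connect (linked (e |: E))).
  apply: connect_sub => x y /existsP[f /andP[fE xy]]; apply: connect1.
  by apply/existsP; exists f; rewrite in_setU1 fE orbT.
have sym : connect_sym (linked (e |: E)).
  apply: sym_connect_sym => x y; apply: eq_existsb => f.
  by rewrite [X in _ && X]andbC.
have tou x : x \in S -> connect (linked (e |: E)) x u.
  move=> xS; have [xS'|xS'] := boolP (x \in S'); first exact: sub (Econn _ _ xS' uS').
  apply: connect1; apply/existsP; exists e.
  by rewrite !inE !eqxx xS xS' orbT.
move=> x y xS yS; apply: connect_trans (tou x xS) _.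
by rewrite sym; exact: tou.
Qed.

Definition meeting (V : finType) (S : {set V}) (E : {set {set V}}) : {set {set V}} :=
  [set e in E | ~~ [disjoint e & S]].

(** A certificate for a butterfly component that depends only on the edges that
    meet S, so that its probability is that of a cylinder event. *)
Lemma planted_butterfly d l (V : finType) (H : hypergraph d.+1 V) (S : {set V})
    (E : {set {set V}}) :
  #|S| = (l * d).+1 -> (forall e, e \in E -> e \subset S) -> #|E| = l ->
  (forall u v, u \in S -> v \in S -> connect (linked E) u v) ->
  meeting S (edges H) = E ->
  S \in components H /\ butterfly_component H S l.
Proof.
move=> cS Esub cE Econn HE.
have EH e : e \in E -> e \in edges H by rewrite -HE inE => /andP[].
have /card_gt0P[r rS] : (0 < #|S|)%N by rewrite cS.
have SE : S = component H r.
  apply/eqP; rewrite eqEsubset; apply/andP; split; apply/fintype.subsetP => v.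
    move=> vS; rewrite inE; apply: (connect_sub _ (Econn r v rS vS)) => x y.
    move=> /existsP[e /andP[eE xy]]; apply: connect1; apply/existsP; exists e.
    by rewrite EH.
  rewrite inE => /connectP[p pp ->].
  elim: p r rS pp => [|w p IH] r rS //= /andP[/existsP[e /andP[He /andP[re we]]] pp].
  apply: IH pp; have eE : e \in E.
    rewrite -HE inE He /=; apply/negP => /pred0P/(_ r).
    by rewrite /= re rS.
  exact: fintype.subsetP (Esub e eE) w we.
have HS : S \in components H by rewrite SE component_in.
have inE' : inner H S = E.
  rewrite -HE; apply/setP => e; rewrite !inE; apply/andP/andP => -[He].
    move=> eS; split=> //; have /card_gt0P[w we] : (0 < #|e|)%N by rewrite (card_edge He).
    by apply/negP => /pred0P/(_ w); rewrite /= we (fintype.subsetP eS).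
  by move=> nd; split=> //; apply: Esub; rewrite -HE inE He.
split=> //; rewrite -cE -inE'; apply: (component_count HS).2.
by rewrite inE' cE cS mulnC.
Qed.

(** * Invariance under isomorphism *)

Lemma imset_comp_id (V W : finType) (f : V -> W) (g : W -> V) (e : {set V}) :
  cancel f g -> g @: (f @: e) = e.
Proof.
move=> fK; rewrite -imset_comp -[RHS]imset_id; apply: eq_imset => x /=.
exact: fK.
Qed.

Lemma hypergraph_iso_sym k (V W : finType) (H : hypergraph k V) (K : hypergraph k W) :
  hypergraph_iso H K -> hypergraph_iso K H.
Proof.
move=> [f [g fK gK] EK]; exists g; first by exists f.
rewrite EK -imset_comp -[LHS]imset_id; apply: eq_imset => e /=.
by rewrite imset_comp_id.
Qed.

Lemma iso_adjacent k (V W : finType) (H : hypergraph k V) (K : hypergraph k W) f :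
  injective f -> edges K = [set f @: (e : {set V}) | e in edges H] ->
  forall u v, adjacent K (f u) (f v) = adjacent H u v.
Proof.
move=> fI EK u v; apply/existsP/existsP => -[e /andP[He /andP[ue ve]]].
  move: He ue ve; rewrite EK => /imsetP[e' He' ->]; rewrite !mem_imset // => ue ve.
  by exists e'; rewrite He' ue.
by exists (f @: e); rewrite EK !mem_imset ?ue ?He //; exact: (imset_inj fI).
Qed.

Lemma iso_connect k (V W : finType) (H : hypergraph k V) (K : hypergraph k W) f :
  bijective f -> edges K = [set f @: (e : {set V}) | e in edges H] ->
  forall u v, connect (adjacent K) (f u) (f v) = connect (adjacent H) u v.
Proof.
move=> [g fK gK] EK u v; have adj := iso_adjacent (can_inj fK) EK.
apply/idP/idP => /connectP[p].
  rewrite -[p](mapK gK) => pp; rewrite last_map => /(can_inj fK) ->.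
  apply/connectP; exists (map g p) => //; move: pp; rewrite path_map.
  by rewrite (eq_path (e' := adjacent H)).
move=> pp ->; apply/connectP; exists (map f p); last by rewrite last_map.
by rewrite path_map (eq_path (e' := adjacent H)).
Qed.

Lemma iso_component k (V W : finType) (H : hypergraph k V) (K : hypergraph k W) f v :
  bijective f -> edges K = [set f @: (e : {set V}) | e in edges H] ->
  component K (f v) = f @: component H v.
Proof.
move=> fB EK; have [g fK gK] := fB; apply/setP => w.
by rewrite -[w]gK mem_imset ?inE ?(iso_connect fB EK) //; exact: can_inj fK.
Qed.

Lemma iso_components k (V W : finType) (H : hypergraph k V) (K : hypergraph k W) f :
  bijective f -> edges K = [set f @: (e : {set V}) | e in edges H] ->
  components K = [set f @: (C : {set V}) | C in components H].
Proof.
move=> fB EK; have [g fK gK] := fB; apply/setP => C; apply/imsetP/imsetP.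
  move=> [w _ ->]; exists (component H (g w)); first exact: component_in.
  by rewrite -(iso_component _ fB EK) gK.
by move=> [_ /imsetP[v _ ->] ->]; exists (f v); rewrite // (iso_component _ fB EK).
Qed.

Lemma iso_connected k (V W : finType) (H : hypergraph k V) (K : hypergraph k W) :
  hypergraph_iso H K -> connected_hypergraph H -> connected_hypergraph K.
Proof.
move=> [f fB EK]; rewrite /connected_hypergraph (iso_components fB EK) => <-.
exact: card_imset (imset_inj (bij_inj fB)).
Qed.

Lemma iso_berge_acyclic k (V W : finType) (H : hypergraph k V) (K : hypergraph k W) :
  hypergraph_iso H K -> berge_acyclic K -> berge_acyclic H.
Proof.
move=> [f /bij_inj fI EK] acK c /andP[cyc un].
pose F (x : V + {set V}) : W + {set W} :=
  match x with inl v => inl (f v) | inr e => inr (f @: e) end.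
have FI : injective F.
  by case=> [v|e] [w|e'] //= [] => [/fI ->|/(imset_inj fI) ->].
have FE x y : incidence K (F x) (F y) = incidence H x y.
  by case: x y => [v|e] [w|e'] //=; rewrite EK !mem_imset //; exact: (imset_inj fI).
rewrite -(size_map F); apply: acK; rewrite /ucycle map_inj_uniq // un andbT.
case: c cyc {un} => //= x c; rewrite -map_rcons path_map.
by rewrite (eq_path (e' := incidence H)).
Qed.

Lemma iso_induced k (V W : finType) (H : hypergraph k V) (K : hypergraph k W)
    f (C : {set V}) :
  injective f -> edges K = [set f @: (e : {set V}) | e in edges H] ->
  hypergraph_iso (induced H C) (induced K (f @: C)).
Proof.
move=> fI EK.
pose phi (v : {v : V | v \in C}) : {w : W | w \in f @: C} :=
  exist _ (f (val v)) (imset_f f (valP v)).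
have phiI : injective phi by move=> u v [] /fI /val_inj.
exists phi.
  by apply: inj_card_bij => //; rewrite !card_sig card_imset.
(* inducing on C commutes with taking the image *)
have key (e : {set V}) : phi @: [set v : {v : V | v \in C} | val v \in e] =
    [set w : {w : W | w \in f @: C} | val w \in f @: e].
  apply/setP => w; rewrite inE; apply/imsetP/imsetP => [[v /[!inE] ve ->]|[v ve wv]].
    by exists (val v).
  have vC : v \in C by have := valP w; rewrite wv mem_imset.
  by exists (exist _ v vC); rewrite ?inE //; apply: val_inj.
apply/setP => x; apply/imsetP/imsetP =>
    [[e' /[!inE] /andP[]]|[_ /imsetP[e /[!inE] /andP[He eC] ->] ->]].
  rewrite EK => /imsetP[e He ->] eC ->.
  exists [set v : {v : V | v \in C} | val v \in e]; last by rewrite key.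
  apply/imsetP; exists e; rewrite // inE He; apply/fintype.subsetP => v ve.
  by have := fintype.subsetP eC (f v) (imset_f f ve); rewrite mem_imset.
exists (f @: e); last by rewrite key.
by rewrite inE EK imset_f //= imsetS.
Qed.

Lemma iso_butterfly_component k (V W : finType) (H : hypergraph k V) (K : hypergraph k W)
    f (C : {set V}) l :
  injective f -> edges K = [set f @: (e : {set V}) | e in edges H] ->
  butterfly_component K (f @: C) l <-> butterfly_component H C l.
Proof.
move=> fI EK.
have tr V' W' (H' : hypergraph k V') (K' : hypergraph k W') : hypergraph_iso H' K' ->
    butterfly H' /\ #|edges H'| = l -> butterfly K' /\ #|edges K'| = l.
  move=> iso [[cH aH] eH]; split; first split.
  - exact: iso_connected iso cH.
  - exact: iso_berge_acyclic (hypergraph_iso_sym iso) aH.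
  - by have [g /bij_inj gI ->] := iso; rewrite card_imset //; exact: (imset_inj gI).
have iso := iso_induced C fI EK.
by split; apply: tr => //; exact: hypergraph_iso_sym.
Qed.

Lemma iso_largest k (V W : finType) (H : hypergraph k V) (K : hypergraph k W)
    f (C : {set V}) :
  bijective f -> edges K = [set f @: (e : {set V}) | e in edges H] ->
  largest_component H C -> largest_component K (f @: C).
Proof.
move=> fB EK [HC mC]; have fI := bij_inj fB; rewrite /largest_component (iso_components fB EK).
split; first exact: imset_f.
by move=> _ /imsetP[C' HC' ->]; rewrite !card_imset //; exact: mC.
Qed.

Lemma iso_others k (V W : finType) (H : hypergraph k V) (K : hypergraph k W)
    f (C : {set V}) l :
  bijective f -> edges K = [set f @: (e : {set V}) | e in edges H] ->
  others_small_butterflies H C l -> others_small_butterflies K (f @: C) l.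
Proof.
move=> fB EK oC C'; rewrite (iso_components fB EK) => /imsetP[B HB ->] BC.
have [|m ml bm] := oC B HB; first by apply: contra_neq BC => ->.
by exists m => //; apply/(iso_butterfly_component _ _ (bij_inj fB) EK).
Qed.

Lemma iso_D k l : iso_invariant (@D k l).
Proof.
suff imp V W (H : hypergraph k V) (K : hypergraph k W) :
    hypergraph_iso H K -> D l H -> D l K.
  by move=> V W H K iso; split; apply: imp => //; exact: hypergraph_iso_sym.
move=> [f fB EK] [C lC oC]; exists (f @: C); first exact: iso_largest lC.
exact: iso_others oC.
Qed.

Lemma iso_Dtilde k l : iso_invariant (@Dtilde k l).
Proof.
suff imp V W (H : hypergraph k V) (K : hypergraph k W) :
    hypergraph_iso H K -> Dtilde l H -> Dtilde l K.
  by move=> V W H K iso; split; apply: imp => //; exact: hypergraph_iso_sym.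
move=> [f fB EK] [nb|[C lC [bC oC]]]; [left|right].
  move=> C'; rewrite (iso_components fB EK) => /imsetP[C HC ->].
  by move=> /(iso_butterfly_component _ _ (bij_inj fB) EK); exact: nb.
exists (f @: C); first exact: iso_largest lC; split; last exact: iso_others oC.
exact/(iso_butterfly_component _ _ (bij_inj fB) EK).
Qed.

Lemma iso_symdiff k l : iso_invariant (symdiff (@D k l) (@Dtilde k l)).
Proof.
move=> V W H K iso; have := iso_D l iso; have := iso_Dtilde l iso.
rewrite /symdiff; tauto.
Qed.

(** * Binomial estimates *)

Lemma ffact_leq_exp n m : (n ^_ m <= n ^ m)%N.
Proof.
rewrite ffact_prod -[X in (_ <= _ ^ X)%N]card_ord -prod_nat_const.
by apply: leq_prod => i _; rewrite leq_subr.
Qed.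

Lemma bin_leq_exp2 n m : ('C(n, m) <= 2 ^ n)%N.
Proof.
rewrite -[n in 'C(n, _)]card_ord -card_draws -[n in (2 ^ n)%N]card_ord -cardsT -card_powerset.
by apply: subset_leq_card; apply/fintype.subsetP => A _; rewrite powersetE finset.subsetT.
Qed.

(** A crude form of Stirling's formula: 'C(2s, s) s! is a product of s factors
    that are at least s, and 'C(2s, s) <= 4^s. *)
Lemma expnn_leq_fact s : (s ^ s <= 4 ^ s * s`!)%N.
Proof.
apply: (@leq_trans ('C(s.*2, s) * s`!)).
  rewrite bin_ffact ffact_prod -[X in (_ ^ X <= _)%N]card_ord -prod_nat_const.
  by apply: leq_prod => i _; have := ltn_ord i; lia.
rewrite leq_mul2r; apply/orP; right; apply: leq_trans (bin_leq_exp2 _ _) _.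
by rewrite -muln2 mulnC expnM.
Qed.

Lemma bin_expnn n s : ('C(n, s) * s ^ s <= 4 ^ s * n ^ s)%N.
Proof.
apply: (@leq_trans ('C(n, s) * (4 ^ s * s`!))); first by rewrite leq_mul2l expnn_leq_fact orbT.
by rewrite mulnCA bin_ffact leq_mul2l ffact_leq_exp orbT.
Qed.

(** The number of ways to choose s vertices and t edges among them.  The factor
    s^(-s) hidden in 'C(n, s) compensates s^(d t), the growth of the number of
    choices of edges, up to exponential factors; this leaves one power of n more
    than n^(d t) when d t = s - 1, and none when d t >= s. *)
Lemma card_dense_sets d n s t : (0 < d)%N -> (1 < s)%N -> (s <= n)%N ->
  (s <= (d * t).+1)%N ->
  ('C(n, s) * 'C('C(s, d.+1), t) <= 4 ^ s * (8 * d) ^ t * n ^ (maxn s (d * t)))%N.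
Proof.
move=> d0 s1 sn st.
have s0 : (0 < s)%N by lia.
have s2 : (s <= 2 * d * t)%N by lia.
have t0 : (0 < t)%N by case: (t) st => [|?] //; rewrite muln0; lia.
have b1 : ('C('C(s, d.+1), t) <= (8 * d) ^ t * s ^ (d * t))%N.
  rewrite -(@leq_pmul2r (s ^ t)) ?expn_gt0 ?s0 //.
  apply: (@leq_trans ('C('C(s, d.+1), t) * ((2 * d) ^ t * t ^ t))).
    by rewrite leq_mul2l -expnMn leq_exp2r ?s2 ?orbT.
  rewrite mulnCA; apply: (@leq_trans ((2 * d) ^ t * (4 ^ t * 'C(s, d.+1) ^ t))).
    by rewrite leq_mul2l bin_expnn orbT.
  rewrite mulnA -expnMn (_ : 2 * d * 4 = 8 * d)%N; last by lia.
  rewrite -mulnA leq_mul2l -expnD; apply/orP; right.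
  rewrite (_ : d * t + t = d.+1 * t)%N; last by rewrite mulSn addnC.
  rewrite expnM leq_exp2r //; apply: leq_trans (ffact_leq_exp _ _).
  by rewrite -bin_ffact leq_pmulr // fact_gt0.
rewrite -(@leq_pmul2r (s ^ s)) ?expn_gt0 ?s0 //.
rewrite mulnAC; apply: leq_trans (leq_mul (bin_expnn n s) b1) _.
rewrite mulnACA -[X in (_ <= X)%N]mulnA leq_mul2l; apply/orP; right.
have [h|h] := leqP s (d * t).
  have [u ->] : exists u, (d * t = u + s)%N by exists (d * t - s)%N; lia.
  have le : (s ^ u <= n ^ u)%N by case: u => // u; rewrite leq_exp2r.
  by rewrite !expnD mulnA [(n ^ u * _)%N]mulnC leq_mul2r leq_mul2l le !orbT.
have -> : (d * t = s.-1)%N by lia.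
by rewrite leq_mul2l leq_exp2l // orbC leq_pred.
Qed.

Local Open Scope ring_scope.

(** * Probabilities of cylinder events *)

Definition ksets n k : {set {set 'I_n}} := [set e : {set 'I_n} | #|e| == k].

(** The probability of an event given as a condition on the edge set, so that
    it can be compared with conditions on arbitrary families of vertex sets. *)
Definition prob_of (R : realType) d n (p : R) (Q : pred {set {set 'I_n}}) : R :=
  \sum_(H : hypergraph d.+1 'I_n | Q (edges H)) random_weight p H.

Lemma random_weight_ge0 (R : realType) d n (p : R) (H : hypergraph d.+1 'I_n) :
  0 <= p <= 1 -> 0 <= random_weight p H.
Proof.
move=> /andP[p0 p1]; apply: prodr_ge0 => e _; case: ifP => _ //.
by rewrite subr_ge0.
Qed.

(** Expand the product, over all vertex sets, of a weight for being an edge plus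
    a weight for not being one: the admissible families contribute the weights
    of the hypergraphs in the cylinder, and all other families contribute 0. *)
Lemma prob_cylinder (R : realType) d n (p : R) (T Z : {set {set 'I_n}}) :
  T \subset ksets n d.+1 -> Z \subset ksets n d.+1 -> [disjoint T & Z] ->
  prob_of d p (fun J => (T \subset J) && [disjoint Z & J]) = p ^+ #|T| * (1 - p) ^+ #|Z|.
Proof.
move=> Tk Zk TZ; set Q := fun J => _.
pose K := ksets n d.+1.
have TK e : e \in T -> e \in K by exact: fintype.subsetP.
have ZK e : e \in Z -> e \in K by exact: fintype.subsetP.
have TZe e : e \in T -> e \in Z -> False.
  by move=> eT eZ; move/pred0P: TZ => /(_ e); rewrite /= eT eZ.
(* F and G are the weights of e being an edge and not being one *)
pose F e : R := if e \in K :\: Z then p else 0.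
pose G e : R := if e \in K then if e \in T then 0 else 1 - p else 1.
transitivity (\prod_e (F e + G e)); last first.
  rewrite (bigID (fun e => e \in T)) /= (bigID (fun e => e \in Z) (fun e => e \notin T)) /=.
  rewrite [X in _ * (_ * X)]big1 ?mulr1; last first.
    move=> e /andP[eT eZ]; rewrite /F /G inE eZ (negbTE eT) /=.
    by case: ifP => _; rewrite ?add0r // addrC subrK.
  rewrite (eq_bigr (fun=> p)); last first.
    move=> e eT; rewrite /F /G inE TK // eT addr0 ifT //=.
    by rewrite andbT; apply/negP => /TZe; apply.
  rewrite prodr_const; congr (_ * _).
  rewrite (eq_bigl (fun e => e \in Z)); last first.
    by move=> e /=; apply/andP/idP => [[]//|eZ]; split=> //; apply/negP => /TZe; apply.
  rewrite (eq_bigr (fun=> 1 - p)); last first.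
    move=> e eZ; rewrite /F /G inE ZK // eZ /= ifF ?add0r //.
    by apply/negP => /TZe; apply.
  by rewrite prodr_const.
rewrite bigA_distr (bigID (fun J : {set {set 'I_n}} => (J \subset K) && Q J)) /=.
rewrite [X in _ = _ + X]big1 ?addr0; last first.
  move=> J; rewrite /Q !negb_and => /or3P[/subsetPn[e eJ eK]|/subsetPn[e eT eJ]|].
  - by rewrite (bigD1 e) //= eJ /F inE (negbTE eK) andbF mul0r.
  - by rewrite (bigD1 e) //= (negbTE eJ) /G (TK _ eT) eT mul0r.
  - move=> /pred0Pn[e /= /andP[eZ eJ]].
    by rewrite (bigD1 e) //= eJ /F inE eZ mul0r.
rewrite [RHS](reindex_omap (val : hypergraph d.+1 'I_n -> _) insub) /=; last first.
  move=> J /andP[/fintype.subsetP JK _]; rewrite insubT //=.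
  by apply/forall_inP => e /JK; rewrite inE.
apply: eq_big => [H|H /andP[TH ZH]].
  rewrite valK eqxx andbT; suff -> : edges H \subset K by [].
  by apply/fintype.subsetP => e He; rewrite inE (card_edge He).
have HK e : e \in edges H -> e \in K by move=> He; rewrite inE (card_edge He).
rewrite /random_weight big_mkcond /=; apply: eq_bigr => e _.
rewrite -[#|e| == _]/(in_mem e (mem (fun e : {set 'I_n} => #|e| == d.+1))).
have -> : (e \in (fun e : {set 'I_n} => #|e| == d.+1)) = (e \in K) by rewrite inE.
have [He|He] := boolP (e \in edges H).
  rewrite /F HK // inE HK // andbT ifT //.
  by apply/negP => eZ; move/pred0P: ZH => /(_ e); rewrite /= eZ He.
rewrite /G; case: ifP => // _; rewrite ifF //.
by apply/negP => eT; move/negP: He; apply; exact: (fintype.subsetP TH).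
Qed.

Lemma prob_of_ge0 (R : realType) d n (p : R) Q : 0 <= p <= 1 -> 0 <= prob_of d (n := n) p Q.
Proof. by move=> p01; apply: sumr_ge0 => H _; exact: random_weight_ge0. Qed.

Lemma prob_total (R : realType) d n (p : R) : prob_of d (n := n) p xpredT = 1.
Proof.
have := @prob_cylinder R d n p set0 set0; rewrite !cards0 !expr0 mulr1 => <-.
- by apply: eq_bigl => H; rewrite sub0set disjoints_subset sub0set.
- exact: sub0set.
- exact: sub0set.
- by rewrite disjoints_subset sub0set.
Qed.

Lemma prob_union (R : realType) d n (p : R) (I : finType) (A : {pred I})
    (P : pred {set {set 'I_n}}) (Q : I -> pred {set {set 'I_n}}) :
  0 <= p <= 1 ->
  (forall H : hypergraph d.+1 'I_n, P (edges H) -> exists2 i, i \in A & Q i (edges H)) ->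
  prob_of d p P <= \sum_(i in A) prob_of d p (Q i).
Proof.
move=> p01 cover; rewrite /prob_of.
under [X in _ <= X]eq_bigr do rewrite big_mkcond.
rewrite exchange_big /= big_mkcond; apply: ler_sum => H _.
have w0 := random_weight_ge0 H p01.
case: ifP => [/cover[i iA Qi]|_].
  rewrite (bigD1 i) //= Qi lerDl; apply: sumr_ge0 => j _; by case: ifP.
by apply: sumr_ge0 => j _; case: ifP.
Qed.

Lemma prob_le (R : realType) d n (p : R) (P Q : pred {set {set 'I_n}}) : 0 <= p <= 1 ->
  (forall H : hypergraph d.+1 'I_n, P (edges H) -> Q (edges H)) ->
  prob_of d p P <= prob_of d p Q.
Proof.
move=> p01 PQ; rewrite /prob_of big_mkcond [leRHS]big_mkcond; apply: ler_sum => H _.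
have w0 := random_weight_ge0 H p01.
by case: ifP => [/PQ -> //|_]; case: ifP.
Qed.

(** * First moment: isolated dense vertex sets *)

Definition crossing n k (S : {set 'I_n}) : {set {set 'I_n}} :=
  [set e in ksets n k | ~~ [disjoint e & S] && ~~ (e \subset S)].

(** A vertex v of S and d vertices outside S form a crossing set, from which v
    and the d vertices are recovered by intersecting with S and its
    complement. *)
Lemma card_crossing n d (S : {set 'I_n}) : (0 < d)%N ->
  (#|S| * 'C(n - #|S|, d) <= #|crossing d.+1 S|)%N.
Proof.
move=> d0; pose D := [set A : {set 'I_n} | A \subset ~: S & #|A| == d].
have cD : #|D| = 'C(n - #|S|, d).
  by rewrite cards_draws; congr 'C(_, _); have := cardsC S; rewrite card_ord; lia.
rewrite -cD -cardsX -(card_in_imset (f := fun x : 'I_n * {set 'I_n} => x.1 |: x.2)).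
  apply: subset_leq_card; apply/fintype.subsetP => _ /imsetP[[v A] vA ->].
  move: vA; rewrite !inE /= => /andP[vS /andP[AS /eqP cA]].
  have vA : v \notin A by apply/negP => /(fintype.subsetP AS); rewrite inE vS.
  rewrite cardsU1 vA cA eqxx /=; apply/andP; split.
    by apply/negP => /pred0P/(_ v); rewrite /= !inE eqxx vS.
  have /card_gt0P[w wA] : (0 < #|A|)%N by rewrite cA.
  apply/negP => /fintype.subsetP/(_ w); rewrite !inE wA orbT => /(_ isT).
  by apply/negP; have := fintype.subsetP AS w wA; rewrite inE.
have key v (A : {set 'I_n}) : v \in S -> A \subset ~: S -> (v |: A) :&: S = [set v].
  move=> vS AS; apply/setP => w; rewrite !inE; have [->|wv] := eqVneq w v; first by rewrite vS.
  by apply/negP => /andP[/= wA]; have := fintype.subsetP AS w wA; rewrite inE => /negP.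
have key2 v (A : {set 'I_n}) : v \in S -> A \subset ~: S -> (v |: A) :\: S = A.
  move=> vS AS; apply/setP => w; rewrite !inE.
  have [wA|wA] := boolP (w \in A).
    by rewrite orbT andbT; have := fintype.subsetP AS w wA; rewrite inE.
  by rewrite orbF; have [->|] := eqVneq w v; rewrite ?vS // andbF.
move=> [v A] [w B]; rewrite !inE /= => /andP[vS /andP[AS _]] /andP[wS /andP[BS _]] e.
have := key _ _ vS AS; rewrite e key // => /set1_inj ->.
by have := key2 _ _ vS AS; rewrite e key2 // => ->.
Qed.

Lemma card_ksets_containing n k (U : {set 'I_n}) :
  (#|[set e in ksets n k | U \subset e]| <= 'C(n - #|U|, k - #|U|))%N.
Proof.
have -> : 'C(n - #|U|, k - #|U|) =
    #|[set A : {set 'I_n} | A \subset ~: U & #|A| == (k - #|U|)%N]|.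
  by rewrite cards_draws; congr 'C(_, _); have := cardsC U; rewrite card_ord; lia.
rewrite -(card_in_imset (f := fun e : {set 'I_n} => e :\: U)
  (D := [set e in ksets n k | U \subset e])).
  apply: subset_leq_card; apply/fintype.subsetP => f /imsetP[e eU ->].
  move: eU; rewrite !inE => /andP[/eqP ce Ue].
  by rewrite cardsD (setIidPr Ue) ce eqxx andbT setDE subsetIr.
move=> e f; rewrite !inE => /andP[_ Ue] /andP[_ Uf] ef.
by rewrite -(setID e U) -(setID f U) ef (setIidPr Ue) (setIidPr Uf).
Qed.

Lemma card_bigcup_le (I T : finType) (A : {set I}) (F : I -> {set T}) :
  (#|\bigcup_(i in A) F i| <= \sum_(i in A) #|F i|)%N.
Proof.
elim/big_rec2: _ => [|i m B _ le]; first by rewrite cards0.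
by apply: leq_trans (leq_card_setU _ _).1 _; rewrite leq_add2l.
Qed.

Lemma card_meeting n d (S : {set 'I_n}) :
  (#|meeting S (ksets n d.+1)| <= #|S| * 'C(n - 1, d))%N.
Proof.
pose F v := [set e in ksets n d.+1 | [set v] \subset e].
apply: (@leq_trans #|\bigcup_(v in S) F v|).
  apply: subset_leq_card; apply/fintype.subsetP => e; rewrite inE => /andP[ek].
  move=> /pred0Pn[v /andP[/= ve vS]]; apply/bigcupP; exists v => //.
  by rewrite inE ek sub1set.
apply: leq_trans (card_bigcup_le _ _) _; rewrite -sum_nat_const; apply: leq_sum => v _.
by have := card_ksets_containing d.+1 [set v]; rewrite cards1 subn1 /= subn1.
Qed.

(** A set that meets both S and S' contains a pair of distinct vertices, and at
    most n^(d - 1) sets of size d + 1 contain a given pair. *)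
Lemma card_meeting_both n d (S S' : {set 'I_n}) : (0 < d)%N -> [disjoint S & S'] ->
  (#|meeting S (ksets n d.+1) :&: meeting S' (ksets n d.+1)|
     <= #|S| * #|S'| * n ^ d.-1)%N.
Proof.
move=> d0 dis; pose F (x : 'I_n * 'I_n) := [set e in ksets n d.+1 | [set x.1; x.2] \subset e].
apply: (@leq_trans #|\bigcup_(x in setX S S') F x|).
  apply: subset_leq_card; apply/fintype.subsetP => e; rewrite !inE => /andP[/andP[ek]].
  move=> /pred0Pn[v /andP[/= ve vS]] /andP[_ /pred0Pn[w /andP[/= we wS]]].
  apply/bigcupP; exists (v, w); first by rewrite inE vS.
  by rewrite !inE /= ek finset.subUset !sub1set ve we.
apply: leq_trans (card_bigcup_le _ _) _; rewrite -cardsX -sum_nat_const.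
apply: leq_sum => -[v w] /setXP[vS wS].
apply: leq_trans (card_ksets_containing _ _) _; rewrite /= cards2.
have -> : v != w by apply/eqP => vw; move/pred0P: dis => /(_ v); rewrite /= vS vw wS.
rewrite /= subSS subn1; apply: leq_trans (_ : (n - 2) ^_ d.-1 <= _)%N.
  by rewrite -bin_ffact leq_pmulr // fact_gt0.
rewrite ffact_prod -[X in (_ <= _ ^ X)%N]card_ord -prod_nat_const; apply: leq_prod => i _.
lia.
Qed.

Section FirstMoment.
Variables (R : realType) (d n : nat) (p : R).
Implicit Types (S : {set 'I_n}).

Lemma card_inner_draws S :
  #|[set e : {set 'I_n} | e \subset S & #|e| == d.+1]| = 'C(#|S|, d.+1).
Proof. exact: cards_draws. Qed.

(** Union bound over the t-subsets of the edges inside S, each present together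
    with the absence of all crossing edges. *)
Lemma prob_isolated_dense S t : (0 < d)%N -> 0 <= p <= 1 ->
  prob_of d p (fun J => [disjoint crossing d.+1 S & J] &&
       (t <= #|[set e in J | e \subset S]|)%N) <=
  'C('C(#|S|, d.+1), t)%:R * p ^+ t * (1 - p) ^+ (#|S| * 'C(n - #|S|, d)).
Proof.
move=> d0 p01; set In := [set e : {set 'I_n} | e \subset S & #|e| == d.+1].
pose Ts := [set T : {set {set 'I_n}} | T \subset In & #|T| == t].
apply: (@le_trans _ _ (\sum_(T in Ts) prob_of d p
   (fun J => (T \subset J) && [disjoint crossing d.+1 S & J]))).
  apply: prob_union => // H /andP[cr le].
  have : (0 < #|[set A : {set {set 'I_n}} | A \subset inner H S & #|A| == t]|)%N.
    by rewrite cards_draws bin_gt0.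
  case/card_gt0P => T; rewrite inE => /andP[TH cT].
  have Tin e : e \in T -> (e \in edges H) && (e \subset S).
    by move=> /(fintype.subsetP TH); rewrite inE.
  exists T; last by rewrite cr andbT; apply/fintype.subsetP => e /Tin/andP[].
  rewrite inE cT andbT; apply/fintype.subsetP => e /Tin/andP[He eS].
  by rewrite inE eS (card_edge He) eqxx.
rewrite -card_inner_draws -cards_draws -/Ts -mulrA mulr_natl -sumr_const.
apply: ler_sum => T; rewrite inE => /andP[TIn /eqP cT].
rewrite prob_cylinder.
- rewrite cT ler_wpM2l ?exprn_ge0 //; first by case/andP: p01.
  by case/andP: p01 => p0 p1; apply: ler_wiXn2l; rewrite ?card_crossing //; lra.
- by apply: fintype.subset_trans TIn _; apply/fintype.subsetP => e; rewrite !inE => /andP[].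
- by apply/fintype.subsetP => e; rewrite inE => /andP[].
- apply/pred0P => e /=; apply/negP => /andP[/(fintype.subsetP TIn)].
  by rewrite !inE => /andP[-> _]; rewrite !andbF.
Qed.

End FirstMoment.

(** * Second moment: isolated butterflies *)

Lemma bernoulli_ineq (R : realType) (x : R) d : 0 <= x <= 1 -> 1 - d%:R * x <= (1 - x) ^+ d.
Proof.
move=> /andP[x0 x1]; elim: d => [|k IH]; first by rewrite mul0r subr0 expr0.
rewrite exprS -natr1; apply: (@le_trans _ _ ((1 - x) * (1 - k%:R * x))).
  have := mulr_ge0 (ler0n R k) (sqr_ge0 x); nra.
by rewrite ler_wpM2l //; lra.
Qed.

(** Chebyshev's inequality for the number X of events [Q i] that occur: with
    mean m, the pairwise bound gives E (X - m)^2 <= m + (r - 1) m^2, and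
    (X - m)^2 = m^2 when no event occurs. *)
Lemma prob_none_le (R : realType) d n (p : R) (I : finType) (A : {set I})
    (Q : I -> pred {set {set 'I_n}}) (r : R) : 0 <= p <= 1 -> 1 <= r ->
  let m := \sum_(i in A) prob_of d p (Q i) in
  0 < m ->
  (forall i j, i \in A -> j \in A -> i != j ->
     prob_of d p (fun J => Q i J && Q j J) <=
       r * (prob_of d p (Q i) * prob_of d p (Q j))) ->
  prob_of d p (fun J => [forall i in A, ~~ Q i J]) <= m^-1 + (r - 1).
Proof.
move=> p01 r1 m m0 pair.
pose w (H : hypergraph d.+1 'I_n) : R := random_weight p H.
pose X (H : hypergraph d.+1 'I_n) : R := \sum_(i in A) (Q i (edges H))%:R.
have w0 H : 0 <= w H by exact: random_weight_ge0.
have EQ (P : pred {set {set 'I_n}}) : \sum_H w H * (P (edges H))%:R = prob_of d p P.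
  rewrite /prob_of [RHS]big_mkcond; apply: eq_bigr => H _.
  by case: (P _); rewrite ?mulr1 ?mulr0.
have EX : \sum_H w H * X H = m.
  rewrite /m (eq_bigr (fun H => \sum_(i in A) w H * (Q i (edges H))%:R)); last first.
    by move=> H _; rewrite mulr_sumr.
  by rewrite exchange_big; apply: eq_bigr => i _; exact: EQ.
have E1 : \sum_H w H = 1 by rewrite -(prob_total d n p).
have EXX : \sum_H w H * X H ^+ 2 <= m + r * m ^+ 2.
  have -> : \sum_H w H * X H ^+ 2 =
      \sum_(i in A) \sum_(j in A) prob_of d p (fun J => Q i J && Q j J).
    transitivity (\sum_(i in A) \sum_(j in A)
        \sum_H w H * (Q i (edges H) && Q j (edges H))%:R).
      under [RHS]eq_bigr do rewrite exchange_big.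
      rewrite exchange_big; apply: eq_bigr => H _ /=.
      rewrite expr2 /X big_distrlr mulr_sumr /=; apply: eq_bigr => i _.
      by rewrite mulr_sumr; apply: eq_bigr => j _; rewrite -mulnb natrM.
    by apply: eq_bigr => i _; apply: eq_bigr => j _; rewrite -EQ.
  have -> : m + r * m ^+ 2 = \sum_(i in A) (prob_of d p (Q i) +
      \sum_(j in A) r * (prob_of d p (Q i) * prob_of d p (Q j))).
    rewrite big_split /=; congr (_ + _).
    rewrite expr2 /m big_distrlr mulr_sumr; apply: eq_bigr => i _.
    by rewrite mulr_sumr.
  apply: ler_sum => i iA; rewrite (bigD1 i) //=; apply: lerD.
    by apply: prob_le => // H /andP[].
  rewrite [leRHS](bigD1 i) //= ler_wpDl //.
    by rewrite !mulr_ge0 ?prob_of_ge0 //; lra.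
  by apply: ler_sum => j /andP[jA ji]; apply: pair => //; rewrite eq_sym.
(* only the hypergraphs with X = 0 are kept *)
have var : prob_of d p (fun J => [forall i in A, ~~ Q i J]) * m ^+ 2 <=
    \sum_H w H * (X H - m) ^+ 2.
  rewrite -EQ mulr_suml; apply: ler_sum => H _.
  rewrite -mulrA ler_wpM2l //; case: (boolP [forall i in A, _]) => [/forall_inP none|_].
    rewrite /X big1 ?sub0r ?sqrrN ?mul1r // => i /none.
    by case: (Q i _).
  by rewrite mul0r sqr_ge0.
have varE : \sum_H w H * (X H - m) ^+ 2 <= m + (r - 1) * m ^+ 2.
  rewrite (eq_bigr (fun H =>
    w H * X H ^+ 2 + (- (2 * m) * (w H * X H) + m ^+ 2 * w H))); last first.
    by move=> H _; ring.
  rewrite big_split big_split -!mulr_sumr EX E1 /=.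
  apply: le_trans (lerD EXX (lexx _)) _.
  by rewrite le_eqVlt; apply/orP; left; apply/eqP; ring.
have m2 : 0 < m ^+ 2 by rewrite exprn_gt0.
rewrite -(ler_pM2r m2); apply: le_trans var _; apply: le_trans varE _.
by rewrite [leRHS]mulrDl (_ : m^-1 * m ^+ 2 = m) // expr2 mulrA mulVf ?mul1r // gt_eqF.
Qed.

(** [prob_none_le] for the events that a given butterfly, one for each set S of
    l d + 1 vertices, is planted on S.  Two such events exclude each other when
    the sets overlap, because both sets would be components; when the sets are
    disjoint, the events fail to be independent only through the at most b
    potential edges that meet both, which costs a factor (1 - p)^(- b).  The event
    that no planted butterfly occurs is returned as the witness Q. *)
Lemma prob_no_butterfly (R : realType) d l n (p : R) : (0 < d)%N -> 0 <= p < 1 ->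
  let s := (l * d).+1 in
  let b := (s * s * n ^ d.-1)%N in
  let m := 'C(n, s)%:R * p ^+ l * (1 - p) ^+ (s * 'C(n - 1, d)) in
  b%:R * p <= 2^-1 -> 0 < m ->
  exists2 Q : pred {set {set 'I_n}},
    forall H : hypergraph d.+1 'I_n, no_butterfly_component l H -> Q (edges H) &
    prob_of d p Q <= m^-1 + 2 * (b%:R * p).
Proof.
move=> d0 /andP[p0 plt1] s b m bp m0.
have p01 : 0 <= p <= 1 by rewrite p0 ltW.
have q0 : 0 < 1 - p by lra.
pose A := [set S : {set 'I_n} | #|S| == s].
have exE (S : {set 'I_n}) : {E : {set {set 'I_n}} | S \in A ->
  [/\ forall e, e \in E -> e \subset S /\ #|e| = d.+1, #|E| = l &
      forall u v, u \in S -> v \in S -> connect (linked E) u v]}.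
  apply: cid; case: (boolP (S \in A)) => [|_]; last by exists set0.
  by rewrite inE => /eqP /(exists_butterfly_edges d0)[E HE]; exists E.
pose E S := sval (exE S).
have EP S : S \in A -> [/\ forall e, e \in E S -> e \subset S /\ #|e| = d.+1,
   #|E S| = l & forall u v, u \in S -> v \in S -> connect (linked (E S)) u v].
  by rewrite /E; case: (exE S).
pose Q S (J : {set {set 'I_n}}) := meeting S J == E S.
pose K := ksets n d.+1.
pose M S := meeting S K.
have EM S : S \in A -> E S \subset M S.
  move=> SA; have [Es _ _] := EP S SA; apply/fintype.subsetP => e eE.
  have [eS ce] := Es e eE; rewrite !inE ce eqxx /=.
  have /card_gt0P[v ve] : (0 < #|e|)%N by rewrite ce.
  by apply/negP => /pred0P/(_ v); rewrite /= ve (fintype.subsetP eS).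
have MK S : M S \subset K by apply/fintype.subsetP => e; rewrite inE => /andP[].
have QE S (H : hypergraph d.+1 'I_n) : S \in A ->
    Q S (edges H) = (E S \subset edges H) && [disjoint M S :\: E S & edges H].
  move=> SA; apply/eqP/andP => [<-|[/fintype.subsetP EH /pred0P dis]].
    split; first by apply/fintype.subsetP => e; rewrite inE => /andP[].
    apply/pred0P => e /=; rewrite !inE; case: (e \in edges H); rewrite ?andbF //=.
    by case: [disjoint _ & _]; rewrite ?andbF ?andbT //= andNb.
  apply/setP => e; rewrite inE; apply/andP/idP => [[He me]|eE].
    apply/negPn/negP => eE; move: (dis e); rewrite /= He andbT in_setD eE /=.
    by rewrite inE me inE (card_edge He) eqxx.
  by have := fintype.subsetP (EM S SA) e eE; rewrite inE => /andP[_ ->]; rewrite EH.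
have PQ S : S \in A -> prob_of d p (Q S) = p ^+ l * (1 - p) ^+ (#|M S| - l).
  move=> SA; have [_ cE _] := EP S SA.
  transitivity (prob_of d p (fun J => (E S \subset J) && [disjoint M S :\: E S & J])).
    by apply: eq_bigl => H; exact: QE.
  rewrite prob_cylinder ?cardsD ?(setIidPr (EM S SA)) ?cE //.
  - exact: fintype.subset_trans (EM S SA) _.
  - exact: fintype.subset_trans (subsetDl _ _) _.
  - by apply/pred0P => e; rewrite /= inE; case: (e \in E S).
exists (fun J => [forall S in A, ~~ Q S J]).
  move=> H nb; apply/forall_inP => S SA; apply/negP => /eqP mE.
  have [Es cE Ec] := EP S SA; rewrite inE in SA.
  have [HS bS] := planted_butterfly (eqP SA) (fun e eE => (Es e eE).1) cE Ec mE.
  exact: nb HS bS.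
pose r := ((1 - p) ^+ b)^-1.
have qb0 : 0 < (1 - p) ^+ b by rewrite exprn_gt0.
have qb : 1 - b%:R * p <= (1 - p) ^+ b := bernoulli_ineq b p01.
have r1 : 1 <= r.
  by rewrite /r invf_ge1 // exprn_ile1 //; lra.
have rb : r - 1 <= 2 * (b%:R * p).
  have x0 : 0 <= b%:R * p by rewrite mulr_ge0.
  rewrite /r lerBlDr -[X in _ <= X]mul1r -ler_pdivrMr; last by lra.
  rewrite -invfM invf_le1; last by rewrite mulr_gt0 //; lra.
  apply: le_trans (_ : (1 - b%:R * p) * (2 * (b%:R * p) + 1) <= _); first by nra.
  by rewrite ler_wpM2r //; lra.
pose mm := \sum_(S in A) prob_of d p (Q S).
have mle : m <= mm.
  have -> : m = \sum_(S in A) p ^+ l * (1 - p) ^+ (s * 'C(n - 1, d)).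
    by rewrite sumr_const card_draws card_ord /m -mulrA mulr_natl.
  apply: ler_sum => S SA; rewrite PQ // ler_wpM2l ?exprn_ge0 //.
  apply: ler_wiXn2l; [lra|lra|]; apply: leq_trans (leq_subr _ _) _.
  by have := card_meeting d S; move: SA; rewrite inE => /eqP ->.
have mm0 : 0 < mm by apply: lt_le_trans mle.
apply: le_trans (prob_none_le p01 r1 mm0 _) _; last first.
  by apply: lerD => //; rewrite lef_pV2 // posrE.
move=> S S' SA S'A SS'.
have [Es cE Ec] := EP S SA; have [Es' cE' Ec'] := EP S' S'A.
have [dis|ndis] := boolP [disjoint S & S']; last first.
  rewrite [leLHS]big1 ?mulr_ge0 ?prob_of_ge0 //; first by lra.
  move=> H /andP[/eqP mE /eqP mE']; case/eqP: SS'.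
  rewrite !inE in SA S'A.
  have [HS _] := planted_butterfly (eqP SA) (fun e eE => (Es e eE).1) cE Ec mE.
  have [HS' _] := planted_butterfly (eqP S'A) (fun e eE => (Es' e eE).1) cE' Ec' mE'.
  move/pred0Pn: ndis => [v /andP[/= vS vS']].
  by rewrite (components_eq HS vS) (components_eq HS' vS').
have EE : [disjoint E S & E S'].
  apply/pred0P => e /=; apply/negP => /andP[/Es[eS ce] /Es'[eS' _]].
  have /card_gt0P[v ve] : (0 < #|e|)%N by rewrite ce.
  by move/pred0P: dis => /(_ v); rewrite /= (fintype.subsetP eS) ?(fintype.subsetP eS').
(* T must be present, and Z, everything else that meets S or S', absent *)
pose T := E S :|: E S'; pose Z := (M S :|: M S') :\: T.
have TM : T \subset M S :|: M S' by apply: setUSS; exact: EM.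
have MMK : M S :|: M S' \subset K by rewrite finset.subUset !MK.
have cT : #|T| = (l + l)%N.
  by rewrite cardsU cE cE' (disjoint_setI0 EE) cards0 subn0.
apply: le_trans (_ : prob_of d p (fun J => (T \subset J) && [disjoint Z & J]) <= _).
  apply: prob_le => // H; rewrite !QE // => /andP[/andP[ES DS] /andP[ES' DS']].
  rewrite finset.subUset ES ES' /=; apply/pred0P => e /=; apply/negP => /andP[].
  rewrite in_setD !in_setU negb_or => /andP[/andP[eES eES'] eM] eH.
  move/pred0P: DS => /(_ e); move/pred0P: DS' => /(_ e).
  rewrite /= !in_setD eES eES' eH !andbT /=.
  by case/orP: eM => ->.
rewrite prob_cylinder; first last.
- by apply/pred0P => e; rewrite /= /Z in_setD; case: (e \in T).
- exact: fintype.subset_trans (subsetDl _ _) _.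
- exact: fintype.subset_trans TM _.
rewrite !PQ // cT /Z cardsD (setIidPr TM) cT.
have cMM := card_meeting_both d0 dis; rewrite -/K -/(M S) -/(M S') in cMM.
rewrite !inE in SA S'A; rewrite (eqP SA) (eqP S'A) -/b in cMM.
have lM : (l <= #|M S|)%N by rewrite -cE subset_leq_card ?EM // inE.
have lM' : (l <= #|M S'|)%N by rewrite -cE' subset_leq_card ?EM // inE.
rewrite /r ler_pdivlMl // mulrACA -!exprD mulrCA ler_wpM2l ?exprn_ge0 // -exprD.
apply: ler_wiXn2l; rewrite ?gerBl ?(ltW q0) //.
move: cMM lM lM' (cardsUI (M S) (M S')); move: #|_ :|: _| #|_ :&: _| #|M S| #|M S'|.
by clearbody b; clear; lia.
Qed.

(** * Union bound over exceptional components *)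

Lemma random_prob_le (R : realType) d n (p : R) (P : property d.+1)
    (Q : pred {set {set 'I_n}}) :
  0 <= p <= 1 -> (forall H : hypergraph d.+1 'I_n, P _ H -> Q (edges H)) ->
  random_prob n p P <= prob_of d p Q.
Proof.
move=> p01 PQ; rewrite /random_prob /prob_of big_mkcond [leRHS]big_mkcond /=.
apply: ler_sum => H _; have w0 := random_weight_ge0 H p01.
by case: asboolP => [/PQ -> //|_]; case: ifP.
Qed.

(** The contribution of the sets of s vertices to the union bound. *)
Definition exceptional_bound (R : realType) d l n (p : R) s : R :=
  ('C(n, s) * 'C('C(s, d.+1), excess_edges d l s))%:R
    * p ^+ excess_edges d l s * (1 - p) ^+ (s * 'C(n - s, d)).

Lemma prob_exceptional (R : realType) d l n (p : R) : (0 < d)%N -> (0 < n)%N ->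
  0 <= p <= 1 ->
  random_prob n p (symdiff (@D d.+1 l) (@Dtilde d.+1 l)) <=
  \sum_(s < n.+1 | (1 < s)%N && (s.*2 <= n)%N) exceptional_bound d l n p s.
Proof.
move=> d0 n0 p01; pose v : 'I_n := Ordinal n0.
pose F (S : {set 'I_n}) (J : {set {set 'I_n}}) := [disjoint crossing d.+1 S & J] &&
   (excess_edges d l #|S| <= #|[set e in J | e \subset S]|)%N.
pose B := [set S : {set 'I_n} | (1 < #|S|)%N && (#|S|.*2 <= n)%N].
apply: (@le_trans _ _ (prob_of d p (fun J => [exists S in B, F S J]))).
  apply: random_prob_le => // H /symdiff_D_Dtilde[nb nD].
  have [S [HS S1 S2 eS]] := exceptional_component v d0 nb nD.
  rewrite card_ord in S2; apply/existsP; exists S; rewrite inE S1 S2 /=.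
  apply/andP; split; last exact: eS.
  apply/pred0P => e /=; apply/negP => /andP[]; rewrite !inE => /andP[_ /andP[nd neS]] He.
  move/pred0Pn: nd => [w /andP[/= we wS]].
  by move/negP: neS; apply; exact: (component_closed HS He we wS).
apply: le_trans (prob_union (A := B) (Q := F) p01 _) _.
  by move=> H /existsP[S /andP[SB FS]]; exists S.
pose f s : R := 'C('C(s, d.+1), excess_edges d l s)%:R * p ^+ excess_edges d l s
   * (1 - p) ^+ (s * 'C(n - s, d)).
apply: (@le_trans _ _ (\sum_(S in B) f #|S|)).
  by apply: ler_sum => S _; exact: prob_isolated_dense.
rewrite (partition_big (fun S : {set 'I_n} => inord #|S| : 'I_n.+1)
  (fun s : 'I_n.+1 => (1 < s)%N && (s.*2 <= n)%N)) /=; last first.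
  by move=> S; rewrite inE inordK // ltnS; have := max_card (mem S); rewrite card_ord.
apply: ler_sum => s /andP[s1 s2].
rewrite (eq_bigr (fun=> f s)); last first.
  move=> S /andP[_ /eqP <-]; rewrite inordK // ltnS.
  by have := max_card (mem S); rewrite card_ord.
rewrite sumr_const -mulr_natl /exceptional_bound /f natrM -!mulrA.
rewrite ler_wpM2r ?ler_nat //.
  by case/andP: p01 => p0 p1; rewrite !mulr_ge0 ?exprn_ge0 //; lra.
rewrite -[X in 'C(X, _)]card_ord -card_draws; apply: subset_leq_card.
apply/fintype.subsetP => S; rewrite !inE => /andP[_ /eqP <-].
by rewrite inordK // ltnS; have := max_card (mem S); rewrite card_ord.
Qed.

(** * Asymptotic preliminaries *)

(** Up to the factor 1 / d!, the expected degree of a vertex. *)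
Definition scaled (R : realType) d n (p : R) : R := p * n%:R ^+ d.
Definition lnn (R : realType) n : R := ln n%:R.

Lemma expR_lnn (R : realType) n : (0 < n)%N -> expR (lnn R n) = n%:R.
Proof. by move=> n0; rewrite lnK // posrE ltr0n. Qed.

Lemma lnn_infty (R : realType) (M : R) : \forall n \near \oo%classic, M <= lnn R n.
Proof.
near=> n; have n0 : (0 < n)%N by near: n; exact: nbhs_infty_ge.
rewrite -ler_expR expR_lnn //; near: n; exact: nbhs_infty_ger.
Unshelve. all: by end_near. Qed.

Lemma one_sub_le_expR (R : realType) (p : R) : 1 - p <= expR (- p).
Proof. exact: expR_ge1Dx. Qed.

(** Bernoulli's inequality applied to 1 - k / n. *)
Lemma power_shift (R : realType) d k (eta : R) : 0 < eta ->
  \forall n \near \oo%classic, (1 - eta) * n%:R ^+ d <= (n - k)%:R ^+ d.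
Proof.
move=> e0; near=> n.
have nk : (k <= n)%N by near: n; exact: nbhs_infty_ge.
have n0 : (0 < n)%N by near: n; exact: nbhs_infty_ge.
have n0' : 0 < n%:R :> R by rewrite ltr0n.
have ne : (d * k)%:R / eta <= n%:R :> R by near: n; exact: nbhs_infty_ger.
rewrite natrB //.
have -> : n%:R - k%:R = (1 - k%:R / n%:R) * n%:R :> R by field; rewrite gt_eqF.
rewrite exprMn ler_wpM2r ?exprn_ge0 //.
apply: (@le_trans _ _ (1 - d%:R * (k%:R / n%:R))).
  rewrite lerD2l lerN2 mulrA -natrM ler_pdivrMr // mulrC -ler_pdivrMr //.
apply: bernoulli_ineq; rewrite divr_ge0 //= ler_pdivrMr // mul1r ler_nat //.
Unshelve. all: by end_near. Qed.

Lemma bin_lower (R : realType) m d : (m - d)%:R ^+ d / d`!%:R <= 'C(m, d)%:R :> R.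
Proof.
rewrite ler_pdivrMr ?ltr0n ?fact_gt0 // -natrM bin_ffact -natrX ler_nat.
rewrite ffact_prod -[X in (_ ^ X <= _)%N]card_ord -prod_nat_const.
by apply: leq_prod => i _; have := ltn_ord i; lia.
Qed.

Lemma bin_upper (R : realType) m d : 'C(m, d)%:R <= m%:R ^+ d / d`!%:R :> R.
Proof.
by rewrite ler_pdivlMr ?ltr0n ?fact_gt0 // -natrM bin_ffact -natrX ler_nat ffact_leq_exp.
Qed.

(** From y <= exp (theta y) / theta; it lets the exponential decay absorb the
    power of y. *)
Lemma pow_le_expR (R : realType) (y theta : R) t s :
  0 <= y -> 0 < theta <= 1 -> (t <= s)%N ->
  y ^+ t <= (theta^-1) ^+ s * expR (s%:R * (theta * y)).
Proof.
move=> y0 /andP[th0 th1] ts.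
have ty0 : 0 <= theta * y by rewrite mulr_ge0 // ltW.
have h : y <= theta^-1 * expR (theta * y).
  rewrite ler_pdivlMl //; have := expR_ge1Dx (theta * y); lra.
rewrite expRM_natl -exprMn; apply: (@le_trans _ _ ((theta^-1 * expR (theta * y)) ^+ t)).
  by apply: lerXn2r; rewrite ?nnegrE // mulr_ge0 ?expR_ge0 // invr_ge0 ltW.
apply: ler_weXn2l => //; rewrite -[1]mulr1; apply: ler_pM => //.
  by rewrite invf_ge1.
by have := expR_ge1Dx (theta * y); lra.
Qed.

(** * Size of one term of the union bound *)

(** The power of n left by [card_dense_sets] is n^(d t) n^(s - d t), where the
    truncated difference s - d t is 0 or 1; the factor n^(d t) turns p^t into
    y^t. *)
Lemma exceptional_bound_le (R : realType) d l n (p : R) s :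
  (0 < d)%N -> (1 < s)%N -> (s <= n)%N -> 0 <= p <= 1 ->
  let t := excess_edges d l s in
  exceptional_bound d l n p s <=
  (32 * d)%:R ^+ s * n%:R ^+ (s - d * t) * scaled d n p ^+ t
    * expR (- (s%:R * (p * 'C(n - s, d)%:R))).
Proof.
move=> d0 s1 sn /andP[p0 p1]; cbv zeta; set t := excess_edges d l s.
rewrite /exceptional_bound -/t.
have p01 : 0 <= 1 - p by lra.
have tspan : (s <= (d * t).+1)%N by exact: excess_edges_span.
have ts : (t <= s)%N by apply: excess_edges_le; lia.
set C := ('C(n, s) * _)%N; pose j := (s - d * t)%N.
have hC : C%:R * p ^+ t <= (32 * d)%:R ^+ s * n%:R ^+ j * scaled d n p ^+ t.
  have -> : (32 * d)%:R ^+ s * n%:R ^+ j * scaled d n p ^+ t =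
      ((32 * d) ^ s * n ^ (j + d * t))%:R * p ^+ t.
    by rewrite /scaled [X in _ = X * _]natrM !natrX exprMn -exprM exprD; ring.
  rewrite ler_wpM2r ?exprn_ge0 // ler_nat.
  apply: leq_trans (card_dense_sets d0 s1 sn tspan) _.
  have -> : maxn s (d * t) = (j + d * t)%N by rewrite /j; lia.
  rewrite leq_mul2r; apply/orP; right.
  apply: (@leq_trans (4 ^ s * (8 * d) ^ s)).
    by rewrite leq_mul2l leq_exp2l ?ts ?orbT //; lia.
  by rewrite -expnMn mulnA.
have hE : (1 - p) ^+ (s * 'C(n - s, d)) <= expR (- (s%:R * (p * 'C(n - s, d)%:R))).
  have -> : - (s%:R * (p * 'C(n - s, d)%:R)) = (s * 'C(n - s, d))%:R * - p.
    by rewrite natrM; ring.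
  rewrite expRM_natl; apply: lerXn2r; rewrite ?nnegrE ?expR_ge0 //.
  exact: one_sub_le_expR.
by apply: ler_pM => //; rewrite ?mulr_ge0 ?exprn_ge0.
Qed.

(** The logarithm of the exponential factor per vertex; theta is the part of the
    decay rate that is spent on absorbing the power of y. *)
Definition overhead (R : realType) d (theta : R) : R := ln ((32 * d)%:R / theta).

Lemma expR_overhead (R : realType) d (theta : R) s : (0 < d)%N -> 0 < theta ->
  expR (s%:R * overhead d theta) = (32 * d)%:R ^+ s * theta^-1 ^+ s.
Proof.
move=> d0 th0; rewrite expRM_natl lnK ?exprMn // posrE divr_gt0 // ltr0n; lia.
Qed.

Section ExceptionalBounds.
Variables (R : realType) (d l n s : nat) (p theta : R).
Hypotheses (d0 : (0 < d)%N) (s1 : (1 < s)%N) (sn : (s <= n)%N) (p01 : 0 <= p <= 1).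
Hypothesis (theta01 : 0 < theta <= 1).
Let t := excess_edges d l s.
Let y := scaled d n p.
Let L := lnn R n.
Let A := overhead d theta.

Let y0 : 0 <= y.
Proof. by rewrite /y /scaled mulr_ge0 ?exprn_ge0 //; case/andP: p01. Qed.

Lemma exceptional_sparse (a : R) : y <= expR (- (a * L)) ->
  exceptional_bound d l n p s <= expR (s%:R * A + (s - d * t)%:R * L - t%:R * (a * L)).
Proof.
move=> ya; have /andP[th0 th1] := theta01; have /andP[p0 p1] := p01.
apply: le_trans (exceptional_bound_le l d0 s1 sn p01) _; rewrite -/t -/y.
rewrite -[X in _ <= expR (_ + X)]mulrN !expRD [expR (s%:R * A)]expR_overhead //.
rewrite [expR ((s - _)%:R * L)]expRM_natl [expR (t%:R * _)]expRM_natl.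
rewrite expR_lnn; last by lia.
rewrite -[leRHS]mulr1; apply: ler_pM; rewrite ?mulr_ge0 ?exprn_ge0 ?expR_ge0 //.
  apply: ler_pM; rewrite ?mulr_ge0 ?exprn_ge0 //.
    rewrite ler_wpM2r ?exprn_ge0 // ler_peMr ?exprn_ge0 //.
    by rewrite exprn_ege1 // invf_ge1.
  by apply: lerXn2r; rewrite ?nnegrE ?expR_ge0.
by rewrite -expR0 ler_expR oppr_le0 !mulr_ge0.
Qed.

Lemma exceptional_dense (b : R) : b * y <= p * 'C(n - s, d)%:R ->
  exceptional_bound d l n p s <=
    expR (s%:R * A + (s - d * t)%:R * L - s%:R * ((b - theta) * y)).
Proof.
move=> yb; have /andP[th0 th1] := theta01; have /andP[p0 p1] := p01.
apply: le_trans (exceptional_bound_le l d0 s1 sn p01) _; rewrite -/t -/y.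
have ts : (t <= s)%N by apply: excess_edges_le; lia.
have -> : s%:R * A + (s - d * t)%:R * L - s%:R * ((b - theta) * y) =
   s%:R * A + (s - d * t)%:R * L + s%:R * (theta * y) + - (s%:R * (b * y)) by ring.
rewrite !expRD [expR (s%:R * A)]expR_overhead //.
rewrite [expR ((s - _)%:R * L)]expRM_natl expR_lnn; last by lia.
apply: ler_pM; rewrite ?mulr_ge0 ?exprn_ge0 ?expR_ge0 //; last first.
  by rewrite ler_expR lerN2 ler_wpM2l.
have := pow_le_expR y0 theta01 ts; set u := _ ^+ t; set v := expR _ => uv.
rewrite -!mulrA ler_wpM2l ?exprn_ge0 // mulrCA ler_wpM2l ?exprn_ge0 //.
Qed.

End ExceptionalBounds.

(** * The union bound in the sparse and dense regimes *)

(** 1 / (l + 1/2), which lies strictly between the exponents 1 / (l + 1) and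
    1 / l (infinity for l = 0) of the appearance of trees with l + 1 and l
    edges. *)
Definition sparse_exponent (R : realType) l : R := 2 / (2 * l%:R + 1).
(** d! / (s + 1/2) with s = l d + 1, slightly less than the value d! / s for
    which isolated trees on s vertices die out, and larger than the
    corresponding value for s + 1 vertices. *)
Definition dense_factor (R : realType) d l : R := 2 * d`!%:R / (2 * (l * d).+1%:R + 1).

Lemma sparse_exponent_gt0 (R : realType) l : 0 < sparse_exponent R l.
Proof. by rewrite divr_gt0 //; have := ler0n R l; lra. Qed.

Lemma dense_factor_gt0 (R : realType) d l : 0 < dense_factor R d l.
Proof.
by rewrite divr_gt0 ?mulr_gt0 ?ltr0n ?fact_gt0 //; have := ler0n R (l * d).+1; lra.
Qed.

Definition outer_regime (R : realType) d l n (p : R) : Prop :=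
  scaled d n p <= expR (- (sparse_exponent R l * lnn R n)) \/
  dense_factor R d l * lnn R n <= scaled d n p.

Lemma excess_edges_half d l s : (0 < d)%N -> (1 < s)%N ->
  (s <= excess_edges d l s * (2 * d))%N.
Proof. by move=> d0 s1; have := excess_edges_span l s d0; lia. Qed.

(** For large s any positive decay rate suffices, so the crude bound
    n - s - d >= n / 4 can replace n; this is where s <= n / 2 is used. *)
Lemma exceptional_tail (R : realType) d l : (0 < d)%N ->
  exists K, \forall n \near \oo%classic, forall s (p : R),
    (K <= s)%N -> (1 < s)%N -> (s.*2 <= n)%N -> 0 <= p <= 1 -> outer_regime d l n p ->
    exceptional_bound d l n p s <= expR (- (2 * lnn R n)).
Proof.
move=> d0.
(* b is the decay rate obtained from n - s - d >= n / 4; half of it absorbs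
   the power of y *)
pose b : R := (4 ^ d * d`!)%:R^-1; pose theta := b / 2; pose A := overhead d theta.
pose a : R := sparse_exponent R l; pose c : R := dense_factor R d l.
have b0 : 0 < b by rewrite invr_gt0 ltr0n muln_gt0 expn_gt0 fact_gt0.
have b1 : b <= 1.
  by rewrite invf_le1 ?ler1n ?ltr0n ?muln_gt0 ?expn_gt0 ?fact_gt0.
have th01 : 0 < theta <= 1 by rewrite /theta; lra.
have a0 : 0 < a := sparse_exponent_gt0 R l.
have c0 : 0 < c := dense_factor_gt0 R d l.
pose alpha := Num.min (theta * c) (a / (2 * d%:R)).
have d0R : 0 < d%:R :> R by rewrite ltr0n.
have th0 : 0 < theta by case/andP: th01.
have al0 : 0 < alpha by rewrite lt_min [0 < theta * c]mulr_gt0 // divr_gt0 // mulr_gt0.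
(* half of the decay pays for the overhead; of the remaining alpha s / 2 >= 3
   powers of n, one cancels the factor n *)
exists (Num.bound (6 / alpha)); near=> n => s p Ks s1 s2 p01 out.
have L1 : 1 <= lnn R n by near: n; exact: lnn_infty.
have LA : 2 * A / alpha <= lnn R n by near: n; exact: lnn_infty.
have n4 : (4 * d <= n)%N by near: n; exact: nbhs_infty_ge.
set L := lnn R n in L1 LA *.
have sn : (s <= n)%N by clear - s2; lia.
have sK : 6 <= alpha * s%:R.
  rewrite mulrC -ler_pdivrMr //; apply: ltW.
  apply: lt_le_trans (archi_boundP _) _; first by rewrite divr_ge0 // ltW.
  by rewrite ler_nat.
have sA : s%:R * A <= alpha * s%:R * L / 2.
  have LA' : 0 <= alpha * L - 2 * A by rewrite subr_ge0 [leRHS]mulrC -ler_pdivrMr.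
  by have := mulr_ge0 (ler0n R s) LA'; lra.
pose t := excess_edges d l s.
have jL : (s - d * t)%:R * L <= L.
  rewrite -[leRHS]mul1r ler_wpM2r ?lern1 //; first by lra.
  by move: (excess_edges_span l s d0); rewrite -/t; clear; lia.
suff [x xs le] : exists2 x, alpha * s%:R * L <= x &
    exceptional_bound d l n p s <= expR (s%:R * A + (s - d * t)%:R * L - x).
  apply: le_trans le _; rewrite ler_expR; nra.
case: out => [sp|de].
  exists (t%:R * (a * L)); last exact: (exceptional_sparse l d0 s1 sn p01 th01 sp).
  rewrite mulrA; apply: ler_wpM2r; first by lra.
  apply: (@le_trans _ _ (a / (2 * d%:R) * s%:R)); first by rewrite ler_wpM2r ?ge_min ?lexx ?orbT.
  rewrite mulrAC ler_pdivrMr; last by lra.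
  rewrite [t%:R * a]mulrC -[leRHS]mulrA ler_wpM2l ?(ltW a0) //.
  by rewrite -!natrM ler_nat; exact: excess_edges_half.
exists (s%:R * ((b - theta) * scaled d n p)).
  rewrite [alpha * _]mulrC -mulrA ler_wpM2l //.
  have -> : b - theta = theta by rewrite /theta; field.
  apply: (@le_trans _ _ (theta * c * L)); last by rewrite -mulrA ler_wpM2l // ltW.
  by rewrite ler_wpM2r ?ge_min ?lexx //; lra.
apply: exceptional_dense => //.
rewrite /scaled mulrCA ler_wpM2l //; first by case/andP: p01.
apply: le_trans (bin_lower R (n - s) d).
rewrite /b natrM natrX invfM mulrAC ler_wpM2r ?invr_ge0 //.
rewrite -exprVn -exprMn; apply: lerXn2r; rewrite ?nnegrE ?mulr_ge0 ?invr_ge0 //.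
rewrite mulrC ler_pdivrMr // -natrM ler_nat.
by clear - s2 n4; lia.
Unshelve. all: by end_near. Qed.

(** For fixed s the constants matter.  If s = d t + 1, the expected number of
    trees carries a factor n, and then t > l and s > l d + 1, so that the decay
    n^(- a t) or n^(- s c / d!) still wins. *)
Lemma exceptional_fixed (R : realType) d l s (eps : R) :
  (0 < d)%N -> (1 < s)%N -> 0 < eps ->
  \forall n \near \oo%classic, forall p : R,
    0 <= p <= 1 -> outer_regime d l n p -> exceptional_bound d l n p s <= eps.
Proof.
move=> d0 s1 eps0.
pose S : R := (l * d).+1%:R; pose w := (2 * S + 1)^-1.
have S1 : 1 <= S by rewrite ler1n.
have w0 : 0 < w by rewrite invr_gt0; lra.
have wS : w * (2 * S + 1) = 1 by rewrite mulVf // gt_eqF //; lra.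
pose f : R := d`!%:R; have f1 : 1 <= f by rewrite ler1n fact_gt0.
(* eta is the relative loss both from n - s - d in place of n and from theta;
   this value makes (S + 1) (1 - 2 eta) = S + 3/4 *)
pose eta := (8 * (S + 1))^-1.
have e0 : 0 < eta by rewrite invr_gt0; lra.
have eS : eta * (S + 1) = 8^-1 by rewrite /eta; field; lra.
have e1 : eta <= 8^-1 by nra.
pose theta := eta / f; pose b := (1 - eta) / f; pose A := overhead d theta.
have th01 : 0 < theta <= 1.
  rewrite divr_gt0 //=; last by lra.
  by rewrite ler_pdivrMr; lra.
pose a := sparse_exponent R l; pose c := dense_factor R d l.
have a0 : 0 < a := sparse_exponent_gt0 R l.
have c0 : 0 < c := dense_factor_gt0 R d l.
have aE : a * l.+1%:R = 1 + a / 2.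
  rewrite /a /sparse_exponent -natr1; field; have := ler0n R l; lra.
pose g := (b - theta) * c.
have gE : g = (1 - 2 * eta) * 2 * w.
  rewrite /g /b /theta /c /dense_factor -/S -/f /w; field; lra.
(* g L is the decay rate per vertex at the edge y = c L of the dense regime *)
have g0 : w <= g by rewrite gE; nra.
have gS : (S + 1) * g = 1 + w / 2.
  rewrite gE; transitivity (2 * w * ((S + 1) - 2 * (eta * (S + 1)))); first by ring.
  rewrite eS; transitivity (w * (2 * S + 1) + w / 2); first by field.
  by rewrite wS.
pose delta := Num.min (a / 2) (w / 2).
have de0 : 0 < delta by rewrite lt_min !divr_gt0.
have dea : delta <= a / 2 by rewrite ge_min lexx.
have dew : delta <= w / 2 by rewrite ge_min lexx orbT.
near=> n => p p01 out.
have sn : (s <= n)%N by near: n; exact: nbhs_infty_ge.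
have L1 : 1 <= lnn R n by near: n; exact: lnn_infty.
have LA : (s%:R * A - ln eps) / delta <= lnn R n by near: n; exact: lnn_infty.
have ps : (1 - eta) * n%:R ^+ d <= (n - (s + d))%:R ^+ d :> R.
  by near: n; exact: power_shift.
set L := lnn R n in L1 LA *; set t := excess_edges d l s.
have small : s%:R * A - delta * L <= ln eps.
  by move: LA; rewrite ler_pdivrMr //; lra.
have [j01 tight] : (s - d * t <= 1)%N /\
    ((s - d * t)%N = 1%N -> (l.+1 <= t)%N /\ ((l * d).+2 <= s)%N).
  have := excess_edges_span l s d0; have := @excess_edges_tight d l s d0 s1; rewrite -/t.
  by clear; move: (d * t)%N => u; lia.
have t0 : (1 <= t)%N by [].
suff [x xj le] : exists2 x, (s - d * t)%:R * L + delta * L <= x &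
    exceptional_bound d l n p s <= expR (s%:R * A + (s - d * t)%:R * L - x).
  apply: le_trans le _; rewrite -[eps]lnK ?posrE // ler_expR; lra.
case: out => [sp|de].
  exists (t%:R * (a * L)); last exact: (exceptional_sparse l d0 s1 sn p01 th01 sp).
  rewrite -mulrDl mulrA ler_wpM2r //; first by lra.
  move: j01 tight; case: (s - d * t)%N => [_ _|[|//] _ /(_ erefl)[tl _]].
    by apply: (@le_trans _ _ a); [lra|rewrite ler_peMl ?ler1n //; lra].
  apply: (@le_trans _ _ (a * l.+1%:R)); first by rewrite aE; lra.
  by rewrite mulrC ler_wpM2r ?ler_nat // ltW.
exists (s%:R * ((b - theta) * scaled d n p)).
  apply: (@le_trans _ _ (s%:R * g * L)).
    rewrite -mulrDl ler_wpM2r //; first by lra.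
    move: j01 tight; case: (s - d * t)%N => [_ _|[|//] _ /(_ erefl)[_ tl]].
      apply: (@le_trans _ _ g); [lra|rewrite ler_peMl ?ler1n //; [lra|]].
      by clear - s1; lia.
    apply: (@le_trans _ _ ((S + 1) * g)); first by rewrite gS; lra.
    rewrite ler_wpM2r; [by []|lra|].
    by rewrite /S natr1 ler_nat.
  have -> : s%:R * g * L = s%:R * ((b - theta) * (c * L)) by rewrite /g; ring.
  rewrite ler_wpM2l // ler_wpM2l //.
  rewrite /b /theta -mulrBl divr_ge0 //; lra.
apply: (@exceptional_dense R d l n s p theta d0 s1 sn p01 th01 b).
rewrite /scaled mulrCA ler_wpM2l //; first by case/andP: p01.
apply: le_trans (bin_lower R (n - s) d).
rewrite /b mulrAC ler_wpM2r ?invr_ge0 //.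
by rewrite -subnDA.
Unshelve. all: by end_near. Qed.

Lemma exceptional_below (R : realType) d l K (eps : R) : (0 < d)%N -> 0 < eps ->
  \forall n \near \oo%classic, forall s (p : R), (s < K)%N -> (1 < s)%N ->
    0 <= p <= 1 -> outer_regime d l n p -> exceptional_bound d l n p s <= eps.
Proof.
move=> d0 e0; elim: K => [|K IH]; first by near=> n.
have [K1|K1] := ltnP 1 K; last first.
  by apply: nearW => n s p sK s1; exfalso; clear -sK s1 K1; lia.
near=> n => s p; rewrite ltnS leq_eqVlt => /orP[/eqP ->|sK] s1 p01 out.
  by move: p p01 out; near: n; exact: exceptional_fixed.
by move: s p sK s1 p01 out; near: n.
Unshelve. all: by end_near. Qed.

(** The sizes below K are finitely many; the at most n + 1 others contribute
    n^(-2) each. *)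
Lemma exceptional_sum (R : realType) d l (eps : R) : (0 < d)%N -> 0 < eps ->
  \forall n \near \oo%classic, forall p : R, 0 <= p <= 1 -> outer_regime d l n p ->
    \sum_(s < n.+1 | (1 < s)%N && (s.*2 <= n)%N) exceptional_bound d l n p s <= eps.
Proof.
move=> d0 e0; have [K tail] := exceptional_tail R l d0.
have e1 : 0 < eps / 2 / K.+1%:R by rewrite !divr_gt0.
near=> n => p p01 out.
have Kn : (K <= n.+1)%N by apply: leqW; near: n; exact: nbhs_infty_ge.
have n0 : (0 < n)%N by near: n; exact: nbhs_infty_ge.
have n4 : 4 / eps <= n%:R by near: n; exact: nbhs_infty_ger.
have below : forall s (p : R), (s < K)%N -> (1 < s)%N -> 0 <= p <= 1 ->
   outer_regime d l n p -> exceptional_bound d l n p s <= eps / 2 / K.+1%:R.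
  by near: n; exact: exceptional_below.
have above : forall s (p : R), (K <= s)%N -> (1 < s)%N -> (s.*2 <= n)%N -> 0 <= p <= 1 ->
   outer_regime d l n p -> exceptional_bound d l n p s <= expR (- (2 * lnn R n)).
  by near: n.
rewrite (bigID (fun s : 'I_n.+1 => (s < K)%N)) /= [leRHS](splitr eps); apply: lerD.
  apply: (@le_trans _ _ (\sum_(s < K) (eps / 2 / K.+1%:R))).
    rewrite [leRHS](big_ord_widen n.+1 (fun=> eps / 2 / K.+1%:R)) //.
    rewrite big_mkcond [leRHS]big_mkcond; apply: ler_sum => s _.
    have [sK|] := ltnP s K; rewrite ?andbF // andbT.
    case: ifP => [/andP[s1 _]|_]; last exact: ltW.
    exact: below.
  rewrite sumr_const card_ord -[leLHS]mulr_natl [leLHS]mulrC -[leLHS]mulrA ger_pMr ?divr_gt0 //.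
  by rewrite mulrC ler_pdivrMr ?ltr0n // mul1r ler_nat.
apply: (@le_trans _ _ (\sum_(s < n.+1) expR (- (2 * lnn R n)))).
  rewrite big_mkcond; apply: ler_sum => s _; case: ifP => [|_]; last exact: expR_ge0.
  by move=> /andP[/andP[s1 s2]]; rewrite -leqNgt => Ks; exact: above.
have n0' : 0 < n%:R :> R by rewrite ltr0n.
have n1 : 1 <= n%:R :> R by rewrite ler1n.
rewrite sumr_const card_ord -[leLHS]mulr_natl expRN mulrC -[2]/(2%:R) expRM_natl expR_lnn //.
rewrite mulrC ler_pdivrMr ?exprn_gt0 // -natr1.
move: n4; rewrite ler_pdivrMr //; set N : R := n%:R in n0' n1 *; nra.
Unshelve. all: by end_near. Qed.

(** * The middle regime and the conclusion *)

(** From ln n <= 2 sqrt n. *)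
Lemma lnn_le_linear (R : realType) (sigma : R) : 0 < sigma ->
  \forall n \near \oo%classic, lnn R n <= sigma * n%:R.
Proof.
move=> s0; near=> n.
have n0 : (0 < n)%N by near: n; exact: nbhs_infty_ge.
have L4 : 4 / sigma <= lnn R n by near: n; exact: lnn_infty.
rewrite -expR_lnn //; set L := lnn R n in L4 *.
have -> : expR L = expR (L / 2) ^+ 2 by rewrite -expRM_natl; congr expR; field.
have L0 : 0 < L by apply: lt_le_trans L4; rewrite divr_gt0.
have Lx : (L / 2) ^+ 2 <= expR (L / 2) ^+ 2.
  by apply: lerXn2r; rewrite ?nnegrE ?expR_ge0 //; have := expR_ge1Dx (L / 2); lra.
apply: le_trans (_ : sigma * (L / 2) ^+ 2 <= _); last by rewrite ler_wpM2l // ltW.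
have : 0 <= (L * sigma - 4) * L 
  by apply: mulr_ge0; [rewrite subr_ge0 -ler_pdivrMr|exact: ltW].
have -> : (L * sigma - 4) * L = 4 * (sigma * (L / 2) ^+ 2 - L) by field.
by rewrite pmulr_rge0 // subr_ge0.
Unshelve. all: by end_near. Qed.

(** A lower bound matching 1 - p <= exp (- p) up to the factor 1 + eta in the
    exponent. *)
Lemma one_sub_ge_expR (R : realType) (eta p : R) :
  0 <= p -> 0 < eta <= 1 -> p <= eta / 2 -> expR (- ((1 + eta) * p)) <= 1 - p.
Proof.
move=> p0 /andP[e0 e1] pe; rewrite expRN -[leLHS]mul1r ler_pdivrMr ?expR_gt0 //.
have := expR_ge1Dx ((1 + eta) * p) => h.
apply: (@le_trans _ _ ((1 - p) * (1 + (1 + eta) * p))).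
  have e2 : 0 <= (1 - eta) * p by rewrite mulr_ge0 //; lra.
  have e3 : 0 <= eta - (1 + eta) * p by lra.
  by have := mulr_ge0 p0 e3; lra.
by rewrite ler_wpM2l //; lra.
Qed.

(** The left-hand side is, up to a constant, n y^l exp (- (1 + eta) s y / d!),
    the order of magnitude of the expected number of isolated trees on s
    vertices. *)
Lemma planted_mean_lower (R : realType) d l n (p eta : R) : (0 < n)%N ->
  0 <= p -> 0 < eta <= 1 -> p <= eta / 2 ->
  let s := (l * d).+1 in
  2^-1 * n%:R ^+ s <= (n - s)%:R ^+ s :> R ->
  (2 * s`!%:R)^-1 * n%:R * scaled d n p ^+ l
    * expR (- ((1 + eta) * s%:R * (scaled d n p / d`!%:R)))
  <= 'C(n, s)%:R * p ^+ l * (1 - p) ^+ (s * 'C(n - 1, d)).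
Proof.
move=> n0 p0 e01 pe s ns; have /andP[e0 e1] := e01.
apply: ler_pM; rewrite ?mulr_ge0 ?exprn_ge0 ?expR_ge0 ?invr_ge0 ?mulr_ge0 //.
  have -> : (2 * s`!%:R)^-1 * n%:R * scaled d n p ^+ l =
     2^-1 * n%:R ^+ s / s`!%:R * p ^+ l :> R.
    rewrite /scaled exprMn -exprM mulnC /s exprS invfM; ring.
  rewrite ler_wpM2r ?exprn_ge0 //; apply: le_trans (bin_lower R n s).
  by rewrite ler_wpM2r // invr_ge0.
apply: (@le_trans _ _ (expR (- ((1 + eta) * p)) ^+ (s * 'C(n - 1, d)))); last first.
  apply: lerXn2r; rewrite ?nnegrE ?expR_ge0 //; first by lra.
  exact: one_sub_ge_expR.
rewrite -expRM_natl ler_expR mulrN lerN2 natrM.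
have -> : s%:R * 'C(n - 1, d)%:R * ((1 + eta) * p) =
  (1 + eta) * s%:R * (p * 'C(n - 1, d)%:R) :> R by ring.
rewrite ler_wpM2l ?mulr_ge0 //; first by lra.
rewrite /scaled -mulrA ler_wpM2l //; apply: le_trans (bin_upper _ _ _) _.
rewrite ler_wpM2r ?invr_ge0 //; apply: lerXn2r; rewrite ?nnegrE //.
by rewrite ler_nat leq_subr.
Qed.

(** The expected number of planted butterflies is at least of order n^delta: for
    y <= 1 since y > n^(-a) and 1 - l a = a / 2, and for y >= 1 since y < c L
    and 1 - (1 + eta) s c / d! > 0.  The correlation term b p is at most a
    multiple of L / n. *)
Lemma middle_regime (R : realType) d l (eps : R) : (0 < d)%N -> 0 < eps ->
  \forall n \near \oo%classic, forall p : R, 0 <= p <= 1 -> ~ outer_regime d l n p ->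
    random_prob n p (symdiff (@D d.+1 l) (@Dtilde d.+1 l)) <= eps.
Proof.
move=> d0 eps0; pose s := (l * d).+1; pose S : R := s%:R.
have S1 : 1 <= S by rewrite ler1n.
pose w := (2 * S + 1)^-1.
have w0 : 0 < w by rewrite invr_gt0; lra.
pose f : R := d`!%:R; have f1 : 1 <= f by rewrite ler1n fact_gt0.
(* this value makes (1 + eta) S = S + 1/4, still below the S + 1/2 in c *)
pose eta := (4 * S)^-1.
have eS : eta * S = 4^-1 by rewrite /eta; field; lra.
have e0 : 0 < eta by rewrite invr_gt0; lra.
have e1 : eta <= 1 by nra.
have e01 : 0 < eta <= 1 by rewrite e0.
pose a := sparse_exponent R l; pose c := dense_factor R d l.
have a0 : 0 < a := sparse_exponent_gt0 R l.
have c0 : 0 < c := dense_factor_gt0 R d l.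
have aE : 1 - l%:R * a = a / 2.
  rewrite /a /sparse_exponent; field; have := ler0n R l; lra.
have cE : 1 - (1 + eta) * S * (c / f) = w / 2.
  have -> : (1 + eta) * S = S + 4^-1 by rewrite mulrDl mul1r eS.
  rewrite /c /dense_factor -/s -/S -/f /w; field; lra.
pose delta := Num.min (a / 2) (w / 2).
have de0 : 0 < delta by rewrite lt_min !divr_gt0.
have dea : delta <= a / 2 by rewrite ge_min lexx.
have dew : delta <= w / 2 by rewrite ge_min lexx orbT.
pose kappa : R := (2 * s`!%:R)^-1.
have k0 : 0 < kappa by rewrite invr_gt0 mulr_gt0 // ltr0n fact_gt0.
pose sigma := Num.min (eta / 2) (eps / 4).
have si0 : 0 < sigma by rewrite lt_min !divr_gt0.
have sie : sigma <= eta / 2 by rewrite ge_min lexx.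
have sieps : sigma <= eps / 4 by rewrite ge_min lexx orbT.
have half0 : 0 < 2^-1 :> R by rewrite invr_gt0.
near=> n => p p01 /not_orP[/negP + /negP]; rewrite -!ltNge => ya yc.
have n0 : (0 < n)%N by near: n; exact: nbhs_infty_ge.
have L0 : 0 <= lnn R n by near: n; exact: lnn_infty.
have LK : (ln (2 / eps / kappa) + (S + 1)) / delta <= lnn R n.
  by near: n; exact: lnn_infty.
(* it makes the correlation term b p, of order c S^2 L / n, at most sigma *)
have Ln : lnn R n <= sigma / (S * S * c) * n%:R.
  near: n; apply: lnn_le_linear; rewrite divr_gt0 // !mulr_gt0 //; lra.
have ns : 2^-1 * n%:R ^+ s <= (n - s)%:R ^+ s :> R.
  have -> : 2^-1 = 1 - 2^-1 :> R by field.
  by near: n; exact: power_shift.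
have n0' : 0 < n%:R :> R by rewrite ltr0n.
rewrite -/a in ya; rewrite -/c in yc.
set L := lnn R n in L0 LK Ln ya yc; set y := scaled d n p in ya yc.
have /andP[p0 p1] := p01.
pose b := (s * s * n ^ d.-1)%N.
have bp : b%:R * p <= sigma.
  rewrite -(ler_pM2r n0').
  have -> : b%:R * p * n%:R = S * S * y.
    rewrite /b /y /scaled !natrM natrX -[in RHS](prednK d0) exprSr -/S; ring.
  apply: (@le_trans _ _ (S * S * (c * L))).
    by rewrite ler_wpM2l ?mulr_ge0 ?(ltW yc) //; lra.
  have SS0 : 0 < S * S * c by rewrite !mulr_gt0 //; lra.
  rewrite mulrA -ler_pdivlMl // mulrA [(_)^-1 * _]mulrC; exact: Ln.
have psig : p <= sigma.
  apply: le_trans bp; rewrite ler_peMl // ler1n /b !muln_gt0 expn_gt0 n0.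
  by [].
have pe : p <= eta / 2 by lra.
have y0 : 0 <= y by apply: le_trans (ltW ya); exact: expR_ge0.
have mlow := @planted_mean_lower R d l n p eta n0 p0 e01 pe ns.
rewrite -/y -/f -/s -/S -/kappa -(expR_lnn R n0) -/L in mlow.
set m := 'C(n, s)%:R * p ^+ l * (1 - p) ^+ (s * 'C(n - 1, d)) in mlow.
have mK : kappa * expR (delta * L - (S + 1)) <= m.
  apply: le_trans mlow; rewrite -[leRHS]mulrA -[leRHS]mulrA ler_wpM2l ?(ltW k0) //.
  have [y1|y1] := leP y 1.
    apply: (@le_trans _ _ (expR L * (expR (l%:R * - (a * L)) * expR (- (S + 1))))).
      rewrite -!expRD ler_expR.
      have : delta * L <= (1 - l%:R * a) * L by rewrite aE ler_wpM2r.
      lra.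
    rewrite ler_wpM2l ?expR_ge0 //; apply: ler_pM; rewrite ?expR_ge0 //.
      by rewrite expRM_natl; apply: lerXn2r; rewrite ?nnegrE ?expR_ge0 // ltW.
    rewrite ler_expR lerN2.
    apply: (@le_trans _ _ ((1 + eta) * S * 1)); last by rewrite mulrDl eS; lra.
    rewrite ler_wpM2l //; first by rewrite mulr_ge0; lra.
    by rewrite ler_pdivrMr; lra.
  apply: (@le_trans _ _ (expR L * (1 * expR (- ((1 + eta) * S * (c * L / f)))))).
    rewrite mul1r -expRD ler_expR.
    have -> : L - (1 + eta) * S * (c * L / f) = (1 - (1 + eta) * S * (c / f)) * L by ring.
    rewrite cE; have : delta * L <= w / 2 * L by rewrite ler_wpM2r.
    lra.
  rewrite ler_wpM2l ?expR_ge0 //; apply: ler_pM; rewrite ?expR_ge0 //.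
    by rewrite exprn_ege1 // ltW.
  rewrite ler_expR lerN2 ler_wpM2l //; first by rewrite mulr_ge0; lra.
  by rewrite ler_wpM2r ?invr_ge0 ?(ltW yc) //; lra.
have m2 : 2 / eps <= m.
  apply: le_trans mK; rewrite [leRHS]mulrC -ler_pdivrMr //.
  rewrite -[leLHS]lnK ?posrE ?divr_gt0 // ler_expR.
  by move: LK; rewrite ler_pdivrMr //; lra.
have m0 : 0 < m by apply: lt_le_trans m2; rewrite divr_gt0.
have plt : 0 <= p < 1 by rewrite p0 /=; lra.
have bp2 : b%:R * p <= 2^-1 by lra.
have [Q HQ PQ] := prob_no_butterfly d0 plt bp2 m0.
apply: (@le_trans _ _ (prob_of d p Q)).
  by apply: random_prob_le => // H /symdiff_D_Dtilde[/HQ].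
apply: le_trans PQ _.
have mi : m^-1 <= eps / 2.
  by rewrite -[leRHS]invrK lef_pV2 ?posrE ?invr_gt0 ?divr_gt0 // invf_div.
apply: (@le_trans _ _ (eps / 2 + 2 * sigma)); last by lra.
by apply: lerD; [exact: mi|rewrite ler_wpM2l].
Unshelve. all: by end_near. Qed.

Theorem theorem6p10 (R : realType) (d : nat) (hd : (1 <= d)%N) (l : nat) :
  @equiv_mod_I R d (@D d.+1 l) (@Dtilde d.+1 l).
Proof.
split; first exact: iso_symdiff.
move=> p _ p01; apply/cvgrPdist_le => eps eps0; near=> n.
have n0 : (0 < n)%N by near: n; exact: nbhs_infty_ge.
have outer : forall p : R, 0 <= p <= 1 -> outer_regime d l n p ->
    \sum_(s < n.+1 | (1 < s)%N && (s.*2 <= n)%N) exceptional_bound d l n p s <= eps.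
  by near: n; exact: exceptional_sum.
have middle : forall p : R, 0 <= p <= 1 -> ~ outer_regime d l n p ->
    random_prob n p (symdiff (@D d.+1 l) (@Dtilde d.+1 l)) <= eps.
  by near: n; exact: middle_regime.
rewrite sub0r normrN ger0_norm; last first.
  by apply: sumr_ge0 => H _; exact: random_weight_ge0.
have [out|mid] := pselect (outer_regime d l n (p n)); last exact: middle.
exact: le_trans (prob_exceptional l hd n0 (p01 n)) (outer _ (p01 n) out).
Unshelve. all: by end_near. Qed.
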